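(* Let $\Omega'$ be a smooth superform of bidegree $(p,q)$ on $H_0=\{(x_0,x)\in\mathbb R^{n+1}:x_0=1\}$, identified with $\mathbb R^n$. Then there is a unique superform $\Omega=:\mathcal E(\Omega')$ of bidegree $(p,q)$ on $\mathbb R^{n+1}_+=\{(x_0,x)\in\mathbb R^{n+1}:x_0>0\}$ that restricts to $\Omega'$ on $H_0$ and satisfies $$L_E(\Omega)=0,\qquad\delta\Omega=0,\qquad\delta^\#\Omega=0.$$ Moreover, $d\Omega=0$ if and only if $d\Omega'=0$ on $H_0$ and $$T'\Omega':=\sum_{i=1}^n dx_i\wedge\delta_{\partial_{\xi_i}}\Omega'=0 .$$ More generally, if $T'(\Omega')=0$, the extension operator commutes with the exterior derivative: $d\,\mathcal E(\Omega')=\mathcal E(d\Omega')$. If $p=q$ and $\Omega'$ is weakly (respectively strongly) positive, then $\Omega$ is weakly (respectively strongly) positive.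
   Context: A superform of bidegree $(p,q)$ on an open set $U\subset\mathbb R^N$ is a form $\alpha=\sum_{|I|=p,|K|=q}\alpha_{IK}(x)\,dx_I\wedge d\xi_K$ on $U\times\mathbb R^N_\xi$ whose coefficients depend only on $x$; $d$ is the exterior derivative. On $\mathbb R^{n+1}$ with coordinates $x_0,\dots,x_n$: $E=\sum_{j=0}^nx_j\partial/\partial x_j$, $E^\#=\sum_{j=0}^nx_j\partial/\partial\xi_j$; $L_E$ is the Lie derivative along $E$ (viewed as a vector field in the $(x,\xi)$-space, with flow $(x,\xi)\mapsto(e^tx,\xi)$), $\delta$ is contraction with $E$, and $\delta^\#$ is contraction with $E^\#$; $\delta_{\partial_{\xi_i}}$ is contraction with $\partial/\partial\xi_i$. The restriction of a superform on $\mathbb R^{n+1}_+$ to $H_0$ is its restriction to the complexification of $H_0$, i.e. one sets $x_0=1$ and discards all terms containing $dx_0$ or $d\xi_0$. Positivity (in $\mathbb R^N$): for a $(1,0)$-form $a=\sum a_jdx_j$, $a^\#=\sum a_jd\xi_j$. An elementary $(p,p)$-form is a constant-coefficient form $a_1\wedge a_1^\#\wedge\dots\wedge a_p\wedge a_p^\#$, $a_j$ of bidegree $(1,0)$. A $(p,p)$-form at a point is strongly positive if it is a finite nonnegative combination of elementary forms; a symmetric $(p,p)$-form (coefficients $\Omega_{IK}=\Omega_{KI}$) is weakly positive if $\Omega\wedge F\ge0$ for all elementary $(N-p,N-p)$-forms $F$, where $f\,dx_1\wedge d\xi_1\wedge\dots\wedge dx_N\wedge d\xi_N\ge0$ means $f\ge0$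 (coordinates on $\mathbb R^{n+1}$ being $x_0,\dots,x_n$). Forms with variable coefficients are positive in one of these senses if they are so at every point. *)

(* Defs.v *)
From HB Require Import structures.
From mathcomp Require Import all_boot all_order all_algebra.
From mathcomp Require Import all_classical all_reals all_analysis.
Set Implicit Arguments.
Unset Strict Implicit.
Unset Printing Implicit Defensive.
Import Order.TTheory GRing.Theory Num.Theory numFieldNormedType.Exports.
Local Open Scope ring_scope.

(* The exterior algebra on dx_i, dxi_i (i < N): the value of a at (I, K) is the
   coefficient of dx_I /\ dxi_K, where dx_I is the wedge of the dx_i, i in I,
   in increasing order, and likewise for dxi_K. *)
Notation extalg R N := {ffun {set 'I_N} * {set 'I_N} -> R^o}.

Definition coef (R : realType) (N : nat) (a : extalg R N)
  (I K : {set 'I_N}) : R := a (I, K).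

Definition ebasis (R : realType) (N : nat) (I K : {set 'I_N}) : extalg R N :=
  [ffun A => (A == (I, K))%:R].

Definition dx (R : realType) (N : nat) (i : 'I_N) : extalg R N :=
  ebasis R [set i] finset.set0.
Definition dxi (R : realType) (N : nat) (i : 'I_N) : extalg R N :=
  ebasis R finset.set0 [set i].
Definition ext1 (R : realType) (N : nat) : extalg R N := ebasis R finset.set0 finset.set0.

(* e_I /\ e_J = (-1)^(inversions I J) e_(I u J) when I and J are disjoint. *)
Definition inversions (N : nat) (I J : {set 'I_N}) : nat :=
  #|[set ij : 'I_N * 'I_N | [&& ij.1 \in I, ij.2 \in J & (ij.2 < ij.1)%N]]|.

(* (dx_I /\ dxi_K) /\ (dx_J /\ dxi_L): moving dx_J in front of dxi_K
   contributes the sign (-1)^(|K||J|). *)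
Definition ebasis_wedge (R : realType) (N : nat) (I K J L : {set 'I_N}) :
    extalg R N :=
  if [disjoint I & J] && [disjoint K & L] then
    (-1) ^+ (inversions I J + #|K| * #|J| + inversions K L)
      *: ebasis R (I :|: J) (K :|: L)
  else 0.

Definition wedge (R : realType) (N : nat) (a b : extalg R N) : extalg R N :=
  \sum_(I : {set 'I_N}) \sum_(K : {set 'I_N})
    \sum_(J : {set 'I_N}) \sum_(L : {set 'I_N})
      (coef a I K * coef b J L) *: ebasis_wedge R I K J L.

(* Contraction of dx_I /\ dxi_K with d/dx_i. *)
Definition ebasis_contr_x (R : realType) (N : nat) (i : 'I_N)
    (I K : {set 'I_N}) : extalg R N :=
  if i \in I then
    (-1) ^+ #|[set j in I | (j < i)%N]| *: ebasis R (I :\ i) K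
  else 0.

(* Contraction of dx_I /\ dxi_K with d/dxi_i. *)
Definition ebasis_contr_xi (R : realType) (N : nat) (i : 'I_N)
    (I K : {set 'I_N}) : extalg R N :=
  if i \in K then
    (-1) ^+ (#|I| + #|[set j in K | (j < i)%N]|) *: ebasis R I (K :\ i)
  else 0.

(* Contraction with the vector sum_i (u_i d/dx_i + v_i d/dxi_i). *)
Definition contraction (R : realType) (N : nat) (u v : 'rV[R]_N)
    (a : extalg R N) : extalg R N :=
  \sum_(I : {set 'I_N}) \sum_(K : {set 'I_N}) coef a I K *:
    \sum_(i < N) (u 0 i *: ebasis_contr_x R i I K
                  + v 0 i *: ebasis_contr_xi R i I K).

Definition bidegree (R : realType) (N p q : nat) (a : extalg R N) : Prop :=
  forall I K : {set 'I_N}, coef a I K != 0 -> #|I| = p /\ #|K| = q.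

(* Superforms are represented by total functions on R^N; on an open set U only
   the values at the points of U matter. *)
Definition superform (R : realType) (N : nat) : Type := 'rV[R]_N -> extalg R N.

Fixpoint is_Ck (R : realType) (N k : nat) (U : set 'rV[R]_N)
    (f : 'rV[R]_N -> R) : Prop :=
  (forall x, U x -> {for x, continuous f}) /\
  match k with
  | 0%N => True
  | k'.+1 => forall j : 'I_N,
      (forall x, U x -> derivable f x 'e_j) /\ is_Ck k' U ('D_'e_j f)
  end.

Definition is_smooth (R : realType) (N : nat) (U : set 'rV[R]_N)
    (f : 'rV[R]_N -> R) : Prop := forall k, is_Ck k U f.

Definition smooth_superform (R : realType) (N : nat) (U : set 'rV[R]_N)
    (alpha : superform R N) : Prop :=
  forall I K : {set 'I_N}, is_smooth U (fun x => coef (alpha x) I K).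

Definition has_bidegree (R : realType) (N p q : nat) (U : set 'rV[R]_N)
    (alpha : superform R N) : Prop :=
  forall x, U x -> bidegree p q (alpha x).

Definition partial (R : realType) (N : nat) (j : 'I_N) (alpha : superform R N) :
    superform R N :=
  fun x => \sum_(I : {set 'I_N}) \sum_(K : {set 'I_N})
    'D_'e_j (fun y => coef (alpha y) I K) x *: ebasis R I K.

(* The coefficients do not depend on xi, so d only involves the dx_j. *)
Definition extd (R : realType) (N : nat) (alpha : superform R N) :
    superform R N :=
  fun x => \sum_(j < N) wedge (dx R j) (partial j alpha x).

(* delta and delta^#: E = sum x_j d/dx_j and E^# = sum x_j d/dxi_j have
   coefficient vector x at the point x. *)
Definition delta (R : realType) (N : nat) (alpha : superform R N) :
    superform R N := fun x => contraction x 0 (alpha x).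
Definition delta_sharp (R : realType) (N : nat) (alpha : superform R N) :
    superform R N := fun x => contraction 0 x (alpha x).

(* Pullback by the flow Phi_t(x, xi) = (e^t x, xi) of E:
   Phi_t^* dx_i = e^t dx_i and Phi_t^* dxi_i = dxi_i. *)
Definition flow_pullback (R : realType) (N : nat) (t : R)
    (alpha : superform R N) : superform R N :=
  fun x => \sum_(I : {set 'I_N}) \sum_(K : {set 'I_N})
    (coef (alpha (expR t *: x)) I K * expR t ^+ #|I|) *: ebasis R I K.

(* On U, the Lie derivative (d/dt)_(t = 0) Phi_t^* alpha exists and is beta. *)
Definition is_lieE (R : realType) (N : nat) (U : set 'rV[R]_N)
    (alpha beta : superform R N) : Prop :=
  forall x, U x -> forall I K : {set 'I_N},
    is_derive (0 : R) (1 : R) (fun t : R => coef (flow_pullback t alpha x) I K)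
      (coef (beta x) I K).

Definition superT (R : realType) (N : nat) (alpha : superform R N) :
    superform R N :=
  fun x => \sum_(i < N) wedge (dx R i) (contraction 0 'e_i (alpha x)).

Definition halfspace (R : realType) (n : nat) : set 'rV[R]_n.+1 :=
  fun x => 0 < x 0 ord0.

(* The point (1, x_1, ..., x_n) of H_0. *)
Definition inclH0 (R : realType) (n : nat) (x : 'rV[R]_n) : 'rV[R]_n.+1 :=
  \row_j (if unlift ord0 j is Some i then x 0 i else 1).

(* The terms dx_I /\ dxi_K that survive are those with 0 in neither I nor K;
   the coordinate x_(i+1) of R^(n+1) is the i-th coordinate of R^n. *)
Definition restrictH0 (R : realType) (n : nat) (alpha : superform R n.+1) :
    superform R n :=
  fun x => \sum_(I : {set 'I_n}) \sum_(K : {set 'I_n})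
    coef (alpha (inclH0 x)) (lift ord0 @: I) (lift ord0 @: K) *: ebasis R I K.

Definition is_extension (R : realType) (n p q : nat) (alpha : superform R n)
    (omega : superform R n.+1) : Prop :=
  [/\ has_bidegree p q (@halfspace R n) omega,
      forall x, restrictH0 omega x = alpha x,
      is_lieE (@halfspace R n) omega (fun _ => 0),
      forall x, halfspace x -> delta omega x = 0 &
      forall x, halfspace x -> delta_sharp omega x = 0].

(* The operator E(alpha); only its values on x_0 > 0 are meaningful, and it is
   the zero form by convention if there is no extension. *)
Definition extension (R : realType) (n p q : nat) (alpha : superform R n) :
    superform R n.+1 :=
  xget ((fun _ => 0) : superform R n.+1)
    (fun omega : superform R n.+1 => is_extension p q alpha omega).

Definition form10 (R : realType) (N : nat) (a : 'rV[R]_N) : extalg R N :=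
  \sum_(j < N) a 0 j *: dx R j.
Definition form10_sharp (R : realType) (N : nat) (a : 'rV[R]_N) : extalg R N :=
  \sum_(j < N) a 0 j *: dxi R j.

Definition elementary (R : realType) (N p : nat) (F : extalg R N) : Prop :=
  exists a : 'I_p -> 'rV[R]_N,
    F = \big[@wedge R N/ext1 R N]_(j < p)
          wedge (form10 (a j)) (form10_sharp (a j)).

Definition strongly_positive (R : realType) (N p : nat) (a : extalg R N) :
    Prop :=
  exists (m : nat) (c : 'I_m -> R) (F : 'I_m -> extalg R N),
    [/\ forall k, 0 <= c k, forall k, elementary p (F k) &
        a = \sum_(k < m) c k *: F k].

Definition volume_form (R : realType) (N : nat) : extalg R N :=
  \big[@wedge R N/ext1 R N]_(j < N) wedge (dx R j) (dxi R j).

Definition top_nonneg (R : realType) (N : nat) (a : extalg R N) : Prop :=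
  exists2 f : R, a = f *: volume_form R N & 0 <= f.

Definition weakly_positive (R : realType) (N p : nat) (a : extalg R N) : Prop :=
  [/\ bidegree p p a,
      forall I K : {set 'I_N}, coef a I K = coef a K I &
      forall (m : nat) (F : extalg R N),
        (p + m = N)%N -> elementary m F -> top_nonneg (wedge a F)].

(* Main.v *)
(* The extension replaces dx_i by d(x_i/x_0) and dxi_i by
   dxi_i - (x_i/x_0) dxi_0; up to a power of x_0 its value at x is
   delta (dx_0 /\ delta# (dxi_0 /\ Omega')), Omega' being taken at x/x_0.

   A form annihilated by delta and delta# at a point with x_0 <> 0 is determined
   by its terms without dx_0 and dxi_0: if these vanish, then
   dxi_0 /\ dx_0 /\ a = 0, and contracting with E and then with E# gives a = 0.
   Since L_E = 0 means homogeneity along rays, such forms are determined by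
   their restriction to H_0, and this uniqueness drives everything else.

   By Cartan's formula delta dOmega = L_E Omega - d delta Omega = 0, while
   delta# dOmega = T Omega with T = sum_j dx_j /\ delta_{d/dxi_j}, and
   T Omega / x_0 is the extension of T' Omega'.  Hence if T' Omega' = 0 then
   dOmega is the extension of dOmega'.

   If b(E) = 0 for all the covectors b, the product of the b /\ b# is, up to a
   power of x_0, the extension of its restriction; this settles strong
   positivity.  For weak positivity, Gaussian elimination turns an elementary
   form F into one with at most one factor b /\ b# such that b(E) <> 0; then
   delta# delta (Omega /\ F) restricts to b(E)^2 (Omega' /\ F') with F'
   elementary on H_0. *)
Require Import Defs.
From HB Require Import structures.
From mathcomp Require Import all_boot all_order all_algebra.
From mathcomp Require Import all_classical all_reals all_analysis.
From mathcomp Require Import ring.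
Set Implicit Arguments.
Unset Strict Implicit.
Unset Printing Implicit Defensive.
Import Order.TTheory GRing.Theory Num.Theory numFieldNormedType.Exports.
Local Open Scope ring_scope.

(** * The exterior algebra *)

Section Ladder.
Context {R : realType} {N : nat}.
Implicit Types (a b : extalg R N) (g h : 'I_N + 'I_N) (e : bool).
Implicit Types (A : {set 'I_N} * {set 'I_N}) (I J K L : {set 'I_N}).

(** Symmetric difference with the singleton of [i]. Insertion and removal become one involution, so
    that products and contractions share one formula in [ladder]. *)
Definition toggle (i : 'I_N) I : {set 'I_N} := [set j | (j == i) (+) (j \in I)].

Definition occupied g A : bool :=
  match g with inl i => i \in A.1 | inr i => i \in A.2 end.

Definition flip g A : {set 'I_N} * {set 'I_N} :=
  match g with inl i => (toggle i A.1, A.2) | inr i => (A.1, toggle i A.2) end.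

Definition below (i : 'I_N) I : {set 'I_N} := [set j in I | (j < i)%N].

(** The number of factors of the monomial [A] standing before the place of [g], all dx being written
    before all dxi. Its parity is the sign for inserting or removing [g]. *)
Definition prior g A : nat :=
  match g with
  | inl i => #|below i A.1|
  | inr i => #|A.1| + #|below i A.2|
  end.

Definition precedes h g : bool :=
  match h, g with
  | inl j, inl i => (j < i)%N
  | inl _, inr _ => true
  | inr _, inl _ => false
  | inr j, inr i => (j < i)%N
  end.

Lemma toggleK i : involutive (toggle i).
Proof. by move=> I; apply/setP=> j; rewrite !inE addbA addbb. Qed.

Lemma toggle_toggle i j I : toggle i (toggle j I) = toggle j (toggle i I).
Proof. by apply/setP=> k; rewrite !inE addbCA. Qed.

Lemma flipK g : involutive (flip g).
Proof. by case: g => i [I K] /=; rewrite toggleK. Qed.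

Lemma flip_flip g h A : flip g (flip h A) = flip h (flip g A).
Proof. by case: g h => i [] j //=; rewrite toggle_toggle. Qed.

Lemma occupied_flip g h A : occupied g (flip h A) = (g == h) (+) occupied g A.
Proof.
case: g h => i [] j //=; rewrite ?inE //.
Qed.

Lemma odd_card_toggle (P : pred 'I_N) i I :
  odd #|[set j in toggle i I | P j]| = odd #|[set j in I | P j]| (+) P i.
Proof.
rewrite (cardsD1 i) [in RHS](cardsD1 i) !inE eqxx !oddD.
have -> : [set j in toggle i I | P j] :\ i = [set j in I | P j] :\ i.
  by apply/setP=> j; rewrite !inE; case: (j == i).
by case: (i \in I); case: (P i) => //=; case: odd.
Qed.

Lemma odd_prior_flip g h A :
  odd (prior g (flip h A)) = odd (prior g A) (+) precedes h g.
Proof.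
have cardT I : #|I| = #|[set j in I | predT j]|.
  by apply: eq_card => j; rewrite !inE andbT.
case: g h => i [] j /=; rewrite /below ?oddD ?odd_card_toggle ?addbF ?addbA //.
by rewrite cardT odd_card_toggle -cardT addbAC.
Qed.

Lemma precedesC g h : g != h -> precedes h g = ~~ precedes g h.
Proof.
case: g h => i [] j //= ij; rewrite -leqNgt ltn_neqAle;
  by case: eqP => // /val_inj ji; rewrite ji eqxx in ij.
Qed.

Lemma precedesxx g : precedes g g = false.
Proof. by case: g => i /=; rewrite ltnn. Qed.

(* [ladder true g] is the exterior product with the generator [g] ([inl i] for
   dx_i, [inr i] for dxi_i), and [ladder false g] is the contraction with the
   dual vector. *)
Definition ladder e g a : extalg R N :=
  [ffun A => if occupied g A == e then (-1) ^+ prior g A * a (flip g A) else 0].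

Lemma ladder_is_linear e g : linear (ladder e g).
Proof.
move=> k a b; apply/ffunP=> A; rewrite !ffunE; case: ifP => _.
  by rewrite mulrDr scalerAr.
by rewrite scaler0 addr0.
Qed.

HB.instance Definition _ e g :=
  GRing.isLinear.Build R (extalg R N) (extalg R N) *:%R (ladder e g)
    (ladder_is_linear e g).

Lemma sign_prior_flip g h A :
  (-1) ^+ prior g (flip h A) = (-1) ^+ prior g A * (-1) ^+ precedes h g :> R.
Proof. by rewrite -signr_odd odd_prior_flip signr_addb signr_odd. Qed.

(** The canonical anticommutation relations. For distinct generators exactly one precedes the other,
    so the two composites carry opposite signs. For equal ones the signs square to 1, and exactly
    one composite survives at each index when [e] and [e'] differ, none when they agree. *)
Lemma ladder_anticomm e e' g h a :
  ladder e g (ladder e' h a) + ladder e' h (ladder e g a)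
  = ((g == h) && (e != e'))%:R *: a.
Proof.
apply/ffunP=> A; rewrite !ffunE !occupied_flip (eq_sym h g) (flip_flip h g).
rewrite !sign_prior_flip; have [<-|gh] /= := eqVneq g h.
  rewrite flipK precedesxx mulr1.
  have ssE : (-1) ^+ prior g A * ((-1) ^+ prior g A * a A) = a A :> R.
    by rewrite mulrA -expr2 sqrr_sign mul1r.
  by case: (occupied g A) e e' => [] [] [] /=;
    rewrite ?ssE ?mulr0 ?addr0 ?add0r ?scale0r ?scale1r.
rewrite (precedesC gh) scale0r.
case: eqP => _; case: eqP => _; rewrite ?mulr0 ?addr0 //.
rewrite -!mulrA [X in _ + X]mulrCA -!mulrDr !mulrA -mulrDl.
by case: precedes; rewrite ?mulr1 /= ?expr1 ?expr0 ?mulr1 ?mulrN1 ?addrN ?addNr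
  mul0r mulr0.
Qed.

(** Exterior product with the one-form of coefficients [w] if [e] is true, contraction with the
    vector of components [w] if [e] is false. *)
Definition ladder_sum e (w : 'I_N + 'I_N -> R) a : extalg R N :=
  \sum_g w g *: ladder e g a.

Lemma ladder_sum_is_linear e w : linear (ladder_sum e w).
Proof.
move=> k a b; rewrite /ladder_sum scaler_sumr -big_split /=.
by apply: eq_bigr => g _; rewrite linearP scalerDr !scalerA mulrC.
Qed.

HB.instance Definition _ e w :=
  GRing.isLinear.Build R (extalg R N) (extalg R N) *:%R (ladder_sum e w)
    (ladder_sum_is_linear e w).

Lemma ladder_sum_anticomm e e' w w' a :
  ladder_sum e w (ladder_sum e' w' a) + ladder_sum e' w' (ladder_sum e w a)
  = ((e != e')%:R * \sum_g w g * w' g) *: a.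
Proof.
rewrite {1 4}/ladder_sum.
under eq_bigr => g _ do rewrite linear_sum /= scaler_sumr.
under [X in _ + X]eq_bigr => g _ do rewrite linear_sum /= scaler_sumr.
rewrite [X in _ + X]exchange_big -big_split mulr_sumr scaler_suml /=.
apply: eq_bigr => g _; rewrite -big_split (bigD1 g) //= big1 ?addr0.
  rewrite !linearZ /= !scalerA (mulrC (w' g)) -scalerDr ladder_anticomm eqxx.
  by rewrite andTb scalerA (mulrC (w g * w' g)).
move=> h hg; rewrite !linearZ /= !scalerA (mulrC (w' h)) -scalerDr.
by rewrite ladder_anticomm eq_sym (negPf hg) scale0r scaler0.
Qed.

End Ladder.

(** * Bilinearity and associativity of the wedge product *)

Section Wedge.
Context {R : realType} {N : nat}.
Implicit Types (a b c : extalg R N) (g h : 'I_N + 'I_N).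
Implicit Types (A B : {set 'I_N} * {set 'I_N}) (I J K L : {set 'I_N}).

Lemma ebasisE I K A : ebasis R I K A = (A == (I, K))%:R.
Proof. by rewrite ffunE. Qed.

Lemma ebasis_pairE A B : ebasis R A.1 A.2 B = (B == A)%:R.
Proof. by rewrite ebasisE -surjective_pairing. Qed.

Lemma extalg_ebasis a : a = \sum_A a A *: ebasis R A.1 A.2.
Proof.
apply/ffunP=> A; rewrite sum_ffunE (bigD1 A) //= big1 ?addr0.
  by rewrite !ffunE -surjective_pairing eqxx [_ *: _]mulr1.
move=> B BA; rewrite !ffunE -surjective_pairing eq_sym (negPf BA).
exact: mulr0.
Qed.

Lemma extalg_linear_ind (P : extalg R N -> Prop) :
  (forall I K, P (ebasis R I K)) ->
  (forall k a b, P a -> P b -> P (k *: a + b)) -> forall a, P a.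
Proof.
move=> Pe Pl a; rewrite [a]extalg_ebasis; elim/big_ind: _ => [|b c Pb Pc|A _].
(* Closure under [k *: a + b] yields zero as (-1) e + e for a basis form e. *)
- by rewrite -(addNr (ebasis R finset.set0 finset.set0)) -scaleN1r; apply: Pl.
- by rewrite -[b]scale1r; apply: Pl.
- rewrite -[_ *: _]addr0 -(addNr (ebasis R A.1 A.2)) -[- _]scaleN1r.
  by apply: (Pl) => //; apply: Pl.
Qed.

Lemma wedgeE a b : wedge a b =
  \sum_A \sum_B (a A * b B) *: ebasis_wedge R A.1 A.2 B.1 B.2.
Proof.
rewrite /wedge pair_bigA; apply: eq_bigr => -[I K] _ /=.
by rewrite pair_bigA; apply: eq_bigr => -[J L] _.
Qed.

Lemma wedge_is_linear a : linear (wedge a).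
Proof.
move=> k b c; rewrite !wedgeE scaler_sumr -big_split; apply: eq_bigr => A _.
rewrite /= scaler_sumr -big_split; apply: eq_bigr => B _ /=.
by rewrite !ffunE scalerA mulrCA -scalerDl mulrDr.
Qed.

HB.instance Definition _ a :=
  GRing.isLinear.Build R (extalg R N) (extalg R N) *:%R (wedge a)
    (wedge_is_linear a).

Lemma wedge_linearl k a b c :
  wedge (k *: a + b) c = k *: wedge a c + wedge b c.
Proof.
rewrite !wedgeE scaler_sumr -big_split; apply: eq_bigr => A _.
rewrite /= scaler_sumr -big_split; apply: eq_bigr => B _ /=.
by rewrite !ffunE scalerA mulrA -scalerDl mulrDl.
Qed.

Lemma wedgeDl a b c : wedge (a + b) c = wedge a c + wedge b c.
Proof. by rewrite -[a]scale1r wedge_linearl !scale1r. Qed.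

Lemma wedge0l c : wedge 0 c = 0.
Proof. by have := wedge_linearl (-1) 0 0 c;
  rewrite scaler0 addr0 scaleN1r addNr. Qed.

Lemma wedgeZl k a c : wedge (k *: a) c = k *: wedge a c.
Proof. by rewrite -[k *: a]addr0 wedge_linearl wedge0l addr0. Qed.

Lemma wedge_suml (T : Type) (r : seq T) (P : pred T) (F : T -> extalg R N) c :
  wedge (\sum_(i <- r | P i) F i) c = \sum_(i <- r | P i) wedge (F i) c.
Proof.
by elim/big_rec2: _ => [|i b d _ <-]; rewrite ?wedge0l ?wedgeDl.
Qed.

Lemma wedge_ebasis I K J L :
  wedge (ebasis R I K) (ebasis R J L) = ebasis_wedge R I K J L.
Proof.
rewrite wedgeE (bigD1 (I, K)) //= [X in _ + X]big1 ?addr0; last first.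
  move=> A AI; rewrite big1 // => B _.
  by rewrite ebasisE (negPf AI) mul0r scale0r.
rewrite (bigD1 (J, L)) //= big1 ?addr0; last first.
  by move=> A AI; rewrite !ebasisE (negPf AI) mulr0 scale0r.
by rewrite !ebasisE !eqxx mulr1 scale1r.
Qed.

Lemma inversionsE I J :
  inversions I J = (\sum_(i in I) \sum_(j in J) (j < i))%N.
Proof.
rewrite /inversions -sum1_card pair_big_dep /= [RHS]big_mkcond.
rewrite [LHS]big_mkcond; apply: eq_bigr => -[i j] _; rewrite inE /=.
by case: (i \in I); case: (j \in J); case: (j < i)%N.
Qed.

Lemma inversions_set1 i J : inversions [set i] J = #|below i J|.
Proof.
rewrite inversionsE big_set1 -sum1_card [LHS]big_mkcond [RHS]big_mkcond.
by apply: eq_bigr => j _; rewrite inE; case: (j \in J); case: (j < i)%N.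
Qed.

Lemma inversions0s J : inversions finset.set0 J = 0%N.
Proof. by rewrite inversionsE big_set0. Qed.

Lemma sum_setU (I J : {set 'I_N}) (F : 'I_N -> nat) : [disjoint I & J] ->
  (\sum_(i in I :|: J) F i = \sum_(i in I) F i + \sum_(i in J) F i)%N.
Proof. by move=> IJ; rewrite -bigU //; apply: eq_bigl => i; rewrite !inE. Qed.

Lemma inversionsUl I J L : [disjoint I & J] ->
  inversions (I :|: J) L = (inversions I L + inversions J L)%N.
Proof. by move=> IJ; rewrite !inversionsE sum_setU. Qed.

Lemma inversionsUr I J L : [disjoint I & J] ->
  inversions L (I :|: J) = (inversions L I + inversions L J)%N.
Proof.
by move=> IJ; rewrite !inversionsE -big_split; apply: eq_bigr => i _;
  rewrite sum_setU.
Qed.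

Lemma disjoint_setUl I J L :
  [disjoint I :|: J & L] = [disjoint I & L] && [disjoint J & L].
Proof. by rewrite -!finset.setI_eq0 finset.setIUl finset.setU_eq0. Qed.

Lemma disjoint_setUr I J L :
  [disjoint L & I :|: J] = [disjoint L & I] && [disjoint L & J].
Proof. by rewrite -!finset.setI_eq0 finset.setIUr finset.setU_eq0. Qed.

(** By trilinearity it is enough to treat monomials. Both sides vanish unless the index sets are
    pairwise disjoint; then the sign exponents are equal as natural numbers, inversions and
    cardinals being additive on disjoint unions. *)
Lemma wedgeA : associative (@wedge R N).
Proof.
move=> a b c; elim/extalg_linear_ind: a => [I1 K1|k a a' IHa IHa']; last first.
  by rewrite !wedge_linearl IHa IHa'.
elim/extalg_linear_ind: b => [I2 K2|k b b' IHb IHb']; last first.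
  by rewrite linearP /= !wedge_linearl linearP /= IHb IHb'.
elim/extalg_linear_ind: c => [I3 K3|k c c' IHc IHc']; last first.
  by rewrite !linearP /= IHc IHc'.
rewrite !wedge_ebasis /ebasis_wedge.
case: ifP => [/andP[I23 K23]|N23]; case: ifP => [/andP[I12 K12]|N12];
  last by rewrite linear0 wedge0l.
- rewrite linearZ wedgeZl /= !wedge_ebasis /ebasis_wedge.
  rewrite !disjoint_setUl !disjoint_setUr I12 K12 I23 K23 !andbT /=.
  case: ifP => [/andP[I13 K13]|_]; last by rewrite !scaler0.
  rewrite !scalerA !finset.setUA -!exprD; congr (_ ^+ _ *: _).
  rewrite !inversionsUl ?inversionsUr // !cardsU.
  move: I23 K12; rewrite -!finset.setI_eq0 => /eqP-> /eqP->.
  by rewrite cards0 !subn0 mulnDl mulnDr; ring.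
- rewrite linearZ /= wedge0l wedge_ebasis /ebasis_wedge !disjoint_setUr.
  case: ifP => [/andP[/andP[I12 _] /andP[K12 _]]|_]; last by rewrite scaler0.
  by rewrite I12 K12 in N12.
- rewrite linear0 wedgeZl wedge_ebasis /ebasis_wedge !disjoint_setUl.
  case: ifP => [/andP[/andP[_ I23] /andP[_ K23]]|_]; last by rewrite scaler0.
  by rewrite I23 K23 in N23.
Qed.

End Wedge.

(** * Products and contractions expressed by ladder operators *)

Section Generators.
Context {R : realType} {N : nat}.
Implicit Types (a b c : extalg R N) (g h : 'I_N + 'I_N).
Implicit Types (A B : {set 'I_N} * {set 'I_N}) (I J K L : {set 'I_N}).

Definition gen g : extalg R N :=
  match g with inl i => dx R i | inr i => dxi R i end.

Lemma toggle_notin i I : i \notin I -> toggle i I = i |: I.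
Proof.
by move=> iI; apply/setP=> j; rewrite !inE; case: eqVneq => // ->;
  rewrite (negPf iI).
Qed.

Lemma toggle_in i I : i \in I -> toggle i I = I :\ i.
Proof.
by move=> iI; apply/setP=> j; rewrite !inE; case: eqVneq => // ->; rewrite iI.
Qed.

Lemma flip_eq g A B : (flip g A == B) = (A == flip g B).
Proof. exact: (inv_eq (flipK g)). Qed.

Lemma ladder_ebasis e g A : ladder e g (ebasis R A.1 A.2) =
  if occupied g A == e then 0
  else (-1) ^+ prior g A *: ebasis R (flip g A).1 (flip g A).2.
Proof.
apply/ffunP=> B; rewrite ffunE ebasis_pairE flip_eq.
have [-> |BA] := eqVneq B (flip g A); last first.
  rewrite mulr0 if_same; case: ifP => _; rewrite ffunE //.
  by rewrite ebasis_pairE (negPf BA) [RHS]mulr0.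
rewrite occupied_flip eqxx mulr1 sign_prior_flip precedesxx mulr1.
case: (occupied g A) e => [] [] /=; rewrite ffunE // ebasis_pairE eqxx;
  by rewrite [RHS]mulr1.
Qed.

(** The sign of the product on monomials is the one given by [prior]: dx_i crosses the smaller
    elements of I, while dxi_i crosses all of dx_I and then the smaller elements of K. *)
Lemma wedge_gen g a : wedge (gen g) a = ladder true g a.
Proof.
elim/(@extalg_linear_ind R N): a => [I K|k a a' IHa IHa']; last first.
  by rewrite !linearP /= IHa IHa'.
have := ladder_ebasis true g (I, K) => /= ->.
case: g => i; rewrite /gen /dx /dxi wedge_ebasis /ebasis_wedge disjoints1;
  rewrite -finset.setI_eq0 finset.set0I eqxx ?andbT ?andTb eqb_id if_neg;
  rewrite inversions_set1 inversions0s finset.set0U /flip /prior /occupied;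
  rewrite -[(I, K).1]/I -[(I, K).2]/K.
  case: ifPn => [_|iI]; first reflexivity.
  by rewrite (toggle_notin iI) cards0 mul0n !addn0.
case: ifPn => [_|iK]; first reflexivity.
by rewrite (toggle_notin iK) cards1 mul1n add0n.
Qed.

(** Serves for vectors and covectors alike: at the point x, [pairv x 0] is E and [pairv 0 x] is E^#,
    whereas [pairv v 0] and [pairv 0 v] are the coefficients of the one-forms v and v^#. *)
Definition pairv (u v : 'rV[R]_N) (g : 'I_N + 'I_N) : R :=
  match g with inl i => u 0 i | inr i => v 0 i end.

Lemma contractionE u v a : Defs.contraction u v a
  = ladder_sum false (pairv u v) a.
Proof.
rewrite [in RHS](extalg_ebasis a) linear_sum /Defs.contraction pair_bigA /=.
apply: eq_bigr => -[I K] _; rewrite linearZ /=; congr (_ *: _).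
rewrite /ladder_sum big_sumType [LHS]big_split; congr (_ + _);
  apply: eq_bigr => i _; congr (_ *: _).
  have := ladder_ebasis false (inl i) (I, K) => /= ->.
  rewrite /ebasis_contr_x eqbF_neg if_neg; case: ifPn => [iI|_];
    last reflexivity.
  by rewrite -(toggle_in iI).
have := ladder_ebasis false (inr i) (I, K) => /= ->.
rewrite /ebasis_contr_xi eqbF_neg if_neg; case: ifPn => [iK|_];
  last reflexivity.
by rewrite -(toggle_in iK).
Qed.

Lemma wedge_form u v a :
  wedge (form10 u + form10_sharp v) a = ladder_sum true (pairv u v) a.
Proof.
rewrite /ladder_sum big_sumType wedgeDl; congr (_ + _);
  rewrite wedge_suml; apply: eq_bigr => i _; rewrite wedgeZl.
  by rewrite -(wedge_gen (inl i)).
by rewrite -(wedge_gen (inr i)).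
Qed.

End Generators.

(** * Antiderivation rules, even factors and bidegrees *)

Section GradedAlgebra.
Context {R : realType} {N : nat}.
Implicit Types (a b c : extalg R N) (g h : 'I_N + 'I_N) (u v x : 'rV[R]_N).
Implicit Types (A B : {set 'I_N} * {set 'I_N}) (I J K L : {set 'I_N}).

Lemma flip_cards g A : occupied g A ->
  (#|A.1| + #|A.2|)%N = (#|(flip g A).1| + #|(flip g A).2|).+1.
Proof.
case: g => i /= iA; rewrite toggle_in //.
  by rewrite (cardsD1 i A.1) iA.
by rewrite (cardsD1 i A.2) iA addnS.
Qed.

(** Induction on the degree |I| + |K|: any generator occurring in a monomial can be removed, and
    creating it again restores the monomial up to sign. *)
Lemma extalg_gen_ind (P : extalg R N -> Prop) :
  P (ext1 R N) -> (forall g a, P a -> P (ladder true g a)) ->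
  (forall k a b, P a -> P b -> P (k *: a + b)) -> forall a, P a.
Proof.
move=> P1 Pg Pl a.
have P0 : P 0 by rewrite -(addNr (ext1 R N)) -scaleN1r; apply: Pl.
elim/(@extalg_linear_ind R N): a => [I K|]; last exact: Pl.
have [m] := ubnP (#|I| + #|K|)%N; elim: m I K => // m IHm I K mIK.
have [/pred0P occ0|/pred0Pn[g /= gIK]] := boolP (pred0b (occupied^~ (I, K))).
  have -> : I = finset.set0 by apply/setP=> i; have /= := occ0 (inl i);
    rewrite inE.
  by have -> : K = finset.set0 by apply/setP=> i; have /= := occ0 (inr i);
    rewrite inE.
pose B := flip g (I, K).
have -> : ebasis R I K = (-1) ^+ prior g B *: ladder true g (ebasis R B.1 B.2).
  rewrite ladder_ebasis occupied_flip eqxx gIK scalerA -expr2 sqrr_sign.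
  by rewrite scale1r flipK.
rewrite -[_ *: _]addr0; apply: Pl => //; apply: Pg; apply: IHm.
by have := flip_cards gIK; move: mIK => /= + E; rewrite E ltnS.
Qed.

Lemma ladderE e h a : ladder e h a = ladder_sum e (fun g => (g == h)%:R) a.
Proof.
rewrite /ladder_sum (bigD1 h) //= eqxx scale1r big1 ?addr0 // => g /negPf ->.
by rewrite scale0r.
Qed.

Lemma ladder_sum_ladder e e' w h a :
  ladder_sum e w (ladder e' h a)
  = ((e != e')%:R * w h) *: a - ladder e' h (ladder_sum e w a).
Proof.
rewrite !ladderE; apply/eqP; rewrite eq_sym subr_eq eq_sym ladder_sum_anticomm.
rewrite (bigD1 h) //= eqxx mulr1 big1 ?addr0 // => g /negPf ->.
by rewrite mulr0.
Qed.

(** Contraction is an antiderivation with respect to the product with a one-form. *)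
Lemma ladder_sum_contract w w' a :
  ladder_sum false w (ladder_sum true w' a)
  = (\sum_g w g * w' g) *: a - ladder_sum true w' (ladder_sum false w a).
Proof.
by apply/eqP; rewrite eq_sym subr_eq eq_sym ladder_sum_anticomm mul1r.
Qed.

Lemma ladder_sumC e w w' a :
  ladder_sum e w (ladder_sum e w' a) = - ladder_sum e w' (ladder_sum e w a).
Proof.
by apply/eqP; rewrite -addr_eq0 ladder_sum_anticomm eqxx mul0r scale0r.
Qed.

Lemma ladder_sum_sqr e w a : ladder_sum e w (ladder_sum e w a) = 0.
Proof.
have /eqP := ladder_sumC e w w a; rewrite -addr_eq0 -mulr2n -scaler_nat.
by rewrite scaler_eq0 pnatr_eq0 => /eqP.
Qed.

Lemma wedge_ladder g a b :
  wedge (ladder true g a) b = ladder true g (wedge a b).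
Proof. by rewrite -!wedge_gen wedgeA. Qed.

Lemma wedge1l : left_id (ext1 R N) (@wedge R N).
Proof.
move=> a; elim/(@extalg_linear_ind R N): a => [I K|k a b IHa IHb].
  rewrite wedge_ebasis /ebasis_wedge !inversions0s cards0 -!finset.setI_eq0.
  by rewrite !finset.set0I eqxx !finset.set0U scale1r.
by rewrite linearP /= IHa IHb.
Qed.

Lemma wedge1r : right_id (ext1 R N) (@wedge R N).
Proof.
move=> a; elim/extalg_gen_ind: a => [|g a IHa|k a b IHa IHb].
- exact: wedge1l.
- by rewrite wedge_ladder IHa.
- by rewrite wedge_linearl IHa IHb.
Qed.

HB.instance Definition _ :=
  Monoid.isLaw.Build (extalg R N) (ext1 R N) (@wedge R N) wedgeA wedge1l
    wedge1r.

Definition square_form v : extalg R N := wedge (form10 v) (form10_sharp v).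

Lemma form10E v a : wedge (form10 v) a = ladder_sum true (pairv v 0) a.
Proof.
rewrite -wedge_form /form10_sharp big1 ?addr0 // => i _.
by rewrite mxE scale0r.
Qed.

Lemma form10_sharpE v a :
  wedge (form10_sharp v) a = ladder_sum true (pairv 0 v) a.
Proof.
rewrite -wedge_form /form10 big1 ?add0r // => i _.
by rewrite mxE scale0r.
Qed.

Lemma square_formE v a : wedge (square_form v) a =
  ladder_sum true (pairv v 0) (ladder_sum true (pairv 0 v) a).
Proof. by rewrite -wedgeA form10_sharpE form10E. Qed.

(** A form of even degree is central: each generator crosses two one-forms and the two signs
    cancel. *)
Lemma square_formC v a : wedge (square_form v) a = wedge a (square_form v).
Proof.
elim/extalg_gen_ind: a => [|g a IHa|k a b IHa IHb].
- by rewrite wedge1l wedge1r.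
- rewrite wedge_ladder -IHa !square_formE !ladder_sum_ladder eqxx mul0r scale0r.
  by rewrite sub0r linearN /= ladder_sum_ladder eqxx mul0r scale0r sub0r opprK.
- by rewrite wedge_linearl linearP /= IHa IHb.
Qed.

Definition dotv u v : R := \sum_i u 0 i * v 0 i.

Lemma sum_pairv u v u' v' :
  \sum_g pairv u v g * pairv u' v' g = dotv u u' + dotv v v'.
Proof. by rewrite big_sumType. Qed.

Lemma dot0v v : dotv 0 v = 0.
Proof. by rewrite /dotv big1 // => i _; rewrite mxE mul0r. Qed.

Lemma dotv0 v : dotv v 0 = 0.
Proof. by rewrite /dotv big1 // => i _; rewrite mxE mulr0. Qed.

Lemma ladder_sum_square (u v x : 'rV[R]_N) a :
  dotv x v = 0 -> dotv u v = 0 ->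
  ladder_sum false (pairv u x) (wedge (square_form v) a)
  = wedge (square_form v) (ladder_sum false (pairv u x) a).
Proof.
move=> xv uv; rewrite !square_formE !ladder_sum_contract !sum_pairv uv xv.
by rewrite !dotv0 !addr0 !scale0r !sub0r linearN /= opprK.
Qed.

Lemma bidegree0 p q : bidegree p q (0 : extalg R N).
Proof. by move=> I K; rewrite /coef ffunE eqxx. Qed.

Lemma bidegree_linear p q k a b :
  bidegree p q a -> bidegree p q b -> bidegree p q (k *: a + b).
Proof.
move=> Ha Hb I K; rewrite /coef !ffunE.
have [aIK|/Ha //] := eqVneq (a (I, K)) 0.
by rewrite aIK scaler0 add0r => /Hb.
Qed.

Lemma bidegree_sum (T : finType) p q (F : T -> extalg R N) :
  (forall i, bidegree p q (F i)) -> bidegree p q (\sum_i F i).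
Proof.
move=> HF; elim/big_ind: _ => [|a b Ha Hb|//]; first exact: bidegree0.
by rewrite -[a]scale1r; apply: bidegree_linear.
Qed.

Lemma bidegreeZ p q k a : bidegree p q a -> bidegree p q (k *: a).
Proof. by move=> Ha; rewrite -[_ *: _]addr0; apply: bidegree_linear => //;
  apply: bidegree0. Qed.

Lemma bidegree_creation p q g a : bidegree p q a ->
  if g is inl _ then bidegree p.+1 q (ladder true g a)
  else bidegree p q.+1 (ladder true g a).
Proof.
case: g => i Ha I K; rewrite /coef ffunE /=; (case: ifP => [/eqP iA|_];
  last by rewrite eqxx);
  rewrite mulf_eq0 negb_or => /andP[_ /Ha []]; rewrite toggle_in //.
  by rewrite [in #|I|](cardsD1 i) iA => -> ->.
by rewrite [in #|K|](cardsD1 i) iA => -> ->.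
Qed.

Lemma bidegree_annihilation p q g a :
  if g is inl _ then bidegree p.+1 q a -> bidegree p q (ladder false g a)
  else bidegree p q.+1 a -> bidegree p q (ladder false g a).
Proof.
case: g => i Ha I K; rewrite /coef ffunE /=; (case: ifP => [/eqP iA|_];
  last by rewrite eqxx);
  rewrite mulf_eq0 negb_or => /andP[_ /Ha []]; rewrite toggle_notin ?iA //;
  rewrite cardsU1 iA add1n.
  by case=> -> ->.
by move=> -> [->].
Qed.

End GradedAlgebra.

(** * Restriction to the slice *)

Section Slice.
Context {R : realType} {n : nat}.
Implicit Types (a b : extalg R n.+1) (c : extalg R n).
Implicit Types (A : {set 'I_n} * {set 'I_n}) (I K : {set 'I_n}).

Definition lift_gen (g : 'I_n + 'I_n) : 'I_n.+1 + 'I_n.+1 :=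
  match g with inl i => inl (lift ord0 i) | inr i => inr (lift ord0 i) end.

Definition lift_pair A : {set 'I_n.+1} * {set 'I_n.+1} :=
  ([set lift ord0 i | i in A.1], [set lift ord0 i | i in A.2]).

(* The pullback to the slice x_0 = 1 of a form at a point of that slice. *)
Definition slice a : extalg R n := [ffun A => a (lift_pair A)].

Lemma slice_is_linear : linear slice.
Proof. by move=> k a b; apply/ffunP=> A; rewrite !ffunE. Qed.

HB.instance Definition _ :=
  GRing.isLinear.Build R (extalg R n.+1) (extalg R n) *:%R slice
    slice_is_linear.

Lemma restrictH0E (alpha : superform R n.+1) x :
  restrictH0 alpha x = slice (alpha (inclH0 x)).
Proof.
rewrite [RHS]extalg_ebasis /restrictH0 pair_bigA; apply: eq_bigr => -[I K] _ /=.
by rewrite ffunE.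
Qed.

Lemma mem_lift (i : 'I_n) I : (lift ord0 i \in [set lift ord0 i | i in I])
  = (i \in I).
Proof. exact/mem_imset/lift_inj. Qed.

Lemma ord0_notin_lift I : (ord0 \in [set lift ord0 i | i in I]) = false.
Proof. by apply/imsetP=> -[i _] /eqP; rewrite (negPf (neq_lift _ _)). Qed.

Lemma toggle_lift (i : 'I_n) I : toggle (lift ord0 i) [set lift ord0 i | i in I]
  = [set lift ord0 i | i in toggle i I].
Proof.
apply/setP=> j; rewrite inE; case: (unliftP ord0 j) => [k|] ->.
  by rewrite !mem_lift inE (inj_eq lift_inj).
by rewrite !ord0_notin_lift (negPf (neq_lift _ _)).
Qed.

Lemma below_lift (i : 'I_n) I : below (lift ord0 i) [set lift ord0 i | i in I]
  = [set lift ord0 i | i in below i I].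
Proof.
apply/setP=> j; rewrite inE; case: (unliftP ord0 j) => [k|] ->.
  by rewrite !mem_lift inE.
by rewrite !ord0_notin_lift.
Qed.

Lemma occupied_lift g A : occupied (lift_gen g) (lift_pair A) = occupied g A.
Proof. by case: g => i /=; rewrite mem_lift. Qed.

Lemma flip_lift g A : flip (lift_gen g) (lift_pair A) = lift_pair (flip g A).
Proof. by case: g => i; rewrite /= toggle_lift. Qed.

Lemma prior_lift g A : prior (lift_gen g) (lift_pair A) = prior g A.
Proof.
by case: g => i /=; rewrite below_lift !(card_imset _ (@lift_inj _ ord0)).
Qed.

(** The map [lift ord0] is increasing and its image avoids 0, so neither the occupation nor the sign
    of a monomial changes. *)
Lemma slice_ladder e g a :
  slice (ladder e (lift_gen g) a) = ladder e g (slice a).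
Proof.
by apply/ffunP=> A; rewrite !ffunE occupied_lift prior_lift flip_lift.
Qed.

Lemma slice_ladder0 g : (g == inl ord0) || (g == inr ord0) ->
  forall a, slice (ladder true g a) = 0.
Proof.
by move=> /orP[] /eqP-> a; apply/ffunP=> A; rewrite !ffunE /= ord0_notin_lift.
Qed.

Lemma sum_lift_gen (V : zmodType) (F : 'I_n.+1 + 'I_n.+1 -> V) :
  \sum_g F g = F (inl ord0) + F (inr ord0) + \sum_g F (lift_gen g).
Proof. by rewrite !big_sumType /= !big_ord_recl addrACA. Qed.

Lemma slice_ladder_sum e w a : slice (ladder_sum e w a) =
  w (inl ord0) *: slice (ladder e (inl ord0) a)
  + w (inr ord0) *: slice (ladder e (inr ord0) a)
  + ladder_sum e (w \o lift_gen) (slice a).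
Proof.
rewrite /ladder_sum sum_lift_gen !linearD !linearZ linear_sum; congr (_ + _).
by apply: eq_bigr => g _; rewrite linearZ /= slice_ladder.
Qed.

Lemma slice_creation w a :
  slice (ladder_sum true w a) = ladder_sum true (w \o lift_gen) (slice a).
Proof.
by rewrite slice_ladder_sum !slice_ladder0 ?eqxx ?orbT // !scaler0 !add0r.
Qed.

Lemma slice_ext1 : slice (ext1 R n.+1) = ext1 R n.
Proof.
apply/ffunP=> -[I K]; rewrite !ffunE; congr ((nat_of_bool _)%:R).
by rewrite /lift_pair !xpair_eqE !imset_eq0.
Qed.

Lemma gen_lift (g : 'I_n.+1 + 'I_n.+1) :
  [|| g == inl ord0, g == inr ord0 | [exists h, g == lift_gen h]].
Proof.
case: g => j; case: (unliftP ord0 j) => [i|] ->; rewrite ?eqxx ?orbT //;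
  apply/orP; right; apply/orP; right; apply/existsP.
  by exists (inl i).
by exists (inr i).
Qed.

(** Pullback is multiplicative. In the induction over generators, dx_0 and dxi_0 make both sides
    vanish, and the other generators commute with [slice]. *)
Lemma slice_wedge a b : slice (wedge a b) = wedge (slice a) (slice b).
Proof.
elim/(@extalg_gen_ind R n.+1): a => [|g a IHa|k a a' IHa IHa'].
- by rewrite slice_ext1 !wedge1l.
- rewrite wedge_ladder; have := gen_lift g;
  rewrite orbA => /orP[g0|/existsP[h /eqP ->]].
    by rewrite !slice_ladder0 // wedge0l.
  by rewrite !slice_ladder wedge_ladder IHa.
- by rewrite linearP /= !wedge_linearl !linearP /= IHa IHa'.
Qed.

(** Pullback under the projection that forgets the coordinates of index 0. *)
Definition unslice c : extalg R n.+1 :=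
  [ffun A : {set 'I_n.+1} * {set 'I_n.+1} =>
    if (ord0 \in A.1) || (ord0 \in A.2) then 0 else
     c (lift ord0 @^-1: A.1, lift ord0 @^-1: A.2)].

Lemma unlift_set I : lift ord0 @^-1: [set lift ord0 i | i in I] = I.
Proof. by apply/setP=> i; rewrite inE mem_lift. Qed.

Lemma lift_set (J : {set 'I_n.+1}) :
  ord0 \notin J -> [set lift ord0 i | i in lift ord0 @^-1: J] = J.
Proof.
move=> J0; apply/setP=> j; case: (unliftP ord0 j) => [i|] ->.
  by rewrite mem_lift inE.
by rewrite ord0_notin_lift (negPf J0).
Qed.

Lemma unsliceK : cancel unslice slice.
Proof.
move=> c; apply/ffunP=> -[I K]; rewrite !ffunE /= !ord0_notin_lift /=.
by rewrite !unlift_set.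
Qed.

Lemma bidegree_unslice p q c : bidegree p q c -> bidegree p q (unslice c).
Proof.
move=> Hc I K; rewrite /coef ffunE /=.
case: ifP => [|/negbT]; first by rewrite eqxx.
rewrite negb_or => /andP[I0 K0] /Hc [<- <-].
by rewrite -{1}(lift_set I0) -{1}(lift_set K0) !(card_imset _ (@lift_inj _ _)).
Qed.

Context (x : 'rV[R]_n.+1).

Lemma contract_slice_inj a : x 0 ord0 != 0 ->
  ladder_sum false (pairv x 0) a = 0 -> ladder_sum false (pairv 0 x) a = 0 ->
  slice a = 0 -> a = 0.
Proof.
move=> x0 ax axi sa.
(* A coefficient of dxi_0 /\ dx_0 /\ a is, up to sign, either zero or a coefficient of [a] at index
   sets avoiding 0, hence one of [slice a]. *)
have a0 : ladder true (inr ord0) (ladder true (inl ord0) a) = 0.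
  apply/ffunP=> -[I K]; rewrite !ffunE /=.
  case: eqP => [K0|_ //]; case: eqP => [I0|_]; last by rewrite mulr0.
  rewrite !toggle_in //; suff -> : a (I :\ ord0, K :\ ord0)
    = 0 by rewrite !mulr0.
  have /ffunP/(_ (lift ord0 @^-1: (I :\ ord0), lift ord0 @^-1: (K :\ ord0))) :=
    sa.
  by rewrite !ffunE /lift_pair /= !lift_set // !inE eqxx.
(* Contraction with E kills [a] and dxi_0 and pairs to x_0 with dx_0; what remains is -x_0 dxi_0 /\
   a. *)
have xi0 : ladder true (inr ord0) a = 0.
  have := congr1 (ladder_sum false (pairv x 0)) a0.
  rewrite !ladder_sum_ladder /= mxE mulr0 scale0r sub0r ax linear0 subr0 mul1r.
  rewrite linear0 linearZ /= => /eqP; rewrite oppr_eq0 scaler_eq0 (negPf x0).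
  by move=> /eqP.
have := congr1 (ladder_sum false (pairv 0 x)) xi0.
rewrite ladder_sum_ladder axi !linear0 addr0 mul1r => /eqP.
by rewrite scaler_eq0 /= (negPf x0) => /eqP.
Qed.

(* x_0^2 times the result of substituting dx_i - (x_i/x_0) dx_0 for dx_i and
   dxi_i - (x_i/x_0) dxi_0 for dxi_i in [c]. *)
Definition cone c : extalg R n.+1 :=
  ladder_sum false (pairv x 0) (ladder true (inl ord0)
    (ladder_sum false (pairv 0 x) (ladder true (inr ord0) (unslice c)))).

Lemma cone_contract_x c : ladder_sum false (pairv x 0) (cone c) = 0.
Proof. exact: ladder_sum_sqr. Qed.

(** Moving the contraction with E^# inwards costs only signs, since E^# pairs to zero with dx_0,
    until it meets the other contraction with E^# and squares to zero. *)
Lemma cone_contract_xi c : ladder_sum false (pairv 0 x) (cone c) = 0.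
Proof.
rewrite /cone ladder_sumC ladder_sum_ladder /= mxE mulr0 scale0r sub0r.
by rewrite ladder_sum_sqr !linear0.
Qed.

(** Of the two terms of the antiderivation rule, the one still containing [g] disappears on the
    slice. *)
Lemma slice_contract0 w g a : (g == inl ord0) || (g == inr ord0) ->
  slice (ladder_sum false w (ladder true g a)) = w g *: slice a.
Proof.
move=> g0; rewrite ladder_sum_ladder mul1r linearB linearZ /=.
by rewrite (slice_ladder0 g0) subr0.
Qed.

Lemma slice_cone c : slice (cone c) = x 0 ord0 ^+ 2 *: c.
Proof.
rewrite /cone !slice_contract0 ?eqxx ?orbT //= unsliceK scalerA.
by rewrite expr2.
Qed.

Lemma bidegree_cone p q c : bidegree p q c -> bidegree p q (cone c).
Proof.
move=> Hc; rewrite /cone.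
have Hx b : bidegree p.+1 q b -> bidegree p q (ladder_sum false (pairv x 0) b).
  move=> Hb; rewrite /ladder_sum big_sumType /=.
  rewrite [X in _ + X]big1 ?addr0; last by move=> i _; rewrite mxE scale0r.
  by apply: bidegree_sum => i; apply/bidegreeZ/(@bidegree_annihilation _ _ _ _
    (inl i)).
have Hxi b : bidegree p q.+1 b -> bidegree p q (ladder_sum false (pairv 0 x) b).
  move=> Hb; rewrite /ladder_sum big_sumType /=.
  rewrite [X in X + _]big1 ?add0r; last by move=> i _; rewrite mxE scale0r.
  by apply: bidegree_sum => i; apply/bidegreeZ/(@bidegree_annihilation _ _ _ _
    (inr i)).
apply/Hx/(@bidegree_creation _ _ _ _ (inl ord0))/Hxi.
exact/(@bidegree_creation _ _ _ _ (inr ord0))/bidegree_unslice.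
Qed.

End Slice.

(** * Pointwise positivity *)

Section Positivity.
Context {R : realType}.

Lemma square_form_prodC N (s : seq 'rV[R]_N) (a : extalg R N) :
  wedge (\big[@wedge R N/ext1 R N]_(v <- s) square_form v) a
  = wedge a (\big[@wedge R N/ext1 R N]_(v <- s) square_form v).
Proof.
elim: s => [|v s IHs]; first by rewrite big_nil wedge1l wedge1r.
rewrite big_cons -(wedgeA (square_form v)) IHs (wedgeA (square_form v)).
by rewrite square_formC -wedgeA.
Qed.

Lemma bidegree_square_prod N p q (s : seq 'rV[R]_N) (a : extalg R N) :
  bidegree p q a -> bidegree (size s + p) (size s + q)
    (wedge (\big[@wedge R N/ext1 R N]_(v <- s) square_form v) a).
Proof.
move=> Ha; elim: s => [|v s IHs]; first by rewrite big_nil wedge1l.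
rewrite big_cons -(wedgeA (square_form v)) [size _]/= !addSn;
  set b := wedge _ a in IHs *.
rewrite square_formE /ladder_sum !big_sumType /=.
rewrite [X in _ + X]big1 ?addr0; last by move=> i _; rewrite mxE scale0r.
rewrite [X in X + _]big1 ?add0r; last by move=> i _; rewrite mxE scale0r.
apply: bidegree_sum => i; apply/bidegreeZ/(@bidegree_creation _ _ _ _ (inl i)).
apply: bidegree_sum => j; apply/bidegreeZ.
exact: (@bidegree_creation _ _ _ _ (inr j)).
Qed.

Lemma ladder_sum_square_prod N u v (s : seq 'rV[R]_N) (a : extalg R N) :
  (forall b, b \in s -> dotv u b = 0 /\ dotv v b = 0) ->
  ladder_sum false (pairv u v)
    (wedge (\big[@wedge R N/ext1 R N]_(b <- s) square_form b) a)
  = wedge (\big[@wedge R N/ext1 R N]_(b <- s) square_form b)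
      (ladder_sum false (pairv u v) a).
Proof.
elim: s => [_|b s IHs sP]; first by rewrite big_nil !wedge1l.
have [ub vb] := sP b (mem_head _ _).
rewrite big_cons -!(wedgeA (square_form b)) ladder_sum_square // IHs // => c cs.
by apply: sP; rewrite inE cs orbT.
Qed.

Lemma contract_ext1 N w : ladder_sum false w (ext1 R N) = 0.
Proof.
rewrite /ladder_sum big1 // => g _.
have := ladder_ebasis false g (finset.set0, finset.set0) => /= ->.
by case: g => i; rewrite /= inE eqxx scaler0.
Qed.

Lemma ladder_sum_eqw N e (w w' : 'I_N + 'I_N -> R) (a : extalg R N) :
  w =1 w' -> ladder_sum e w a = ladder_sum e w' a.
Proof. by move=> ww'; apply: eq_bigr => g _; rewrite ww'. Qed.

Definition tail_row n (b : 'rV[R]_n.+1) : 'rV[R]_n := \row_i b 0 (lift ord0 i).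

Lemma slice_square_form n (b : 'rV[R]_n.+1) :
  slice (square_form b) = square_form (tail_row b).
Proof.
rewrite -[square_form b]wedge1r square_formE !slice_creation slice_ext1.
rewrite -[RHS]wedge1r square_formE.
rewrite (ladder_sum_eqw _ _ (w' := pairv (tail_row b) 0)); last first.
  by case=> i; rewrite /= ?mxE.
congr (ladder_sum _ _ _); apply: ladder_sum_eqw.
by case=> i; rewrite /= ?mxE.
Qed.

Lemma slice_square_prod n (s : seq 'rV[R]_n.+1) :
  slice (\big[@wedge R n.+1/ext1 R n.+1]_(v <- s) square_form v)
  = \big[@wedge R n/ext1 R n]_(v <- [seq tail_row b | b <- s]) square_form v.
Proof.
rewrite (big_morph _ (@slice_wedge R n) (slice_ext1)) big_map.
by apply: eq_bigr => b _; rewrite slice_square_form.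
Qed.

Lemma elementaryP N p (F : extalg R N) : elementary p F <->
  exists2 s : seq 'rV[R]_N, size s = p &
    F = \big[@wedge R N/ext1 R N]_(v <- s) square_form v.
Proof.
split=> [[a ->]|[s <- ->]].
  exists [seq a j | j <- index_enum 'I_p]; last by rewrite big_map.
  by rewrite size_map -[RHS]card_ord cardE enumT.
by exists (tnth (in_tuple s)); rewrite big_tnth.
Qed.

(** The row operation of the elimination: every extra term contains v or v^# twice. *)
Lemma square_form_shear N (v b : 'rV[R]_N) k (a : extalg R N) :
  wedge (square_form v) (wedge (square_form (b - k *: v)) a)
  = wedge (square_form v) (wedge (square_form b) a).
Proof.
rewrite !square_formE.
have xE (c : extalg R N) : ladder_sum true (pairv (b - k *: v) 0) c =
    ladder_sum true (pairv b 0) c - k *: ladder_sum true (pairv v 0) c.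
  rewrite /ladder_sum scaler_sumr -sumrB; apply: eq_bigr => -[] i _ /=;
    by rewrite ?mxE ?scale0r ?scaler0 ?subr0 // scalerBl scalerA.
have xiE (c : extalg R N) : ladder_sum true (pairv 0 (b - k *: v)) c =
    ladder_sum true (pairv 0 b) c - k *: ladder_sum true (pairv 0 v) c.
  rewrite /ladder_sum scaler_sumr -sumrB; apply: eq_bigr => -[] i _ /=;
    by rewrite ?mxE ?scale0r ?scaler0 ?subr0 // scalerBl scalerA.
have shear w0 w w' (c : extalg R N) :
    (forall d : extalg R N, ladder_sum true w' d
      = ladder_sum true w d - k *: ladder_sum true w0 d) ->
    ladder_sum true w0 (ladder_sum true w' c)
      = ladder_sum true w0 (ladder_sum true w c).
  by move=> ->; rewrite linearB linearZ /= ladder_sum_sqr scaler0 subr0.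
(* The two middle factors are exchanged, so that v stands next to b - kv and v^# next to its
   sharp. *)
rewrite (ladder_sumC _ (pairv 0 v) (pairv (b - k *: v) 0)).
rewrite (ladder_sumC _ (pairv 0 v) (pairv b 0)) (shear _ _ _ _ xiE).
by rewrite !linearN /=; congr (- _); apply: shear.
Qed.

Lemma square_formCA N (v b : 'rV[R]_N) (a : extalg R N) :
  wedge (square_form v) (wedge (square_form b) a)
  = wedge (square_form b) (wedge (square_form v) a).
Proof.
rewrite (wedgeA (square_form v) (square_form b)).
by rewrite (square_formC v (square_form b)) -wedgeA.
Qed.

(* Gaussian elimination by [square_form_shear]. *)
Lemma square_prod_eliminate N (x : 'rV[R]_N) (s : seq 'rV[R]_N) : s != [::] ->
  exists b t, [/\ size s = (size t).+1, forall c, c \in t -> dotv x c = 0 &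
    \big[@wedge R N/ext1 R N]_(v <- s) square_form v =
    wedge (square_form b) (\big[@wedge R N/ext1 R N]_(v <- t) square_form v)].
Proof.
case: (boolP (has (fun v => dotv x v != 0) s)) => [|/hasPn s0]; last first.
  case: s s0 => // b t s0 _; exists b, t; split=> //; last by rewrite big_cons.
  by move=> c ct; apply/eqP/negPn/s0; rewrite inE ct orbT.
move=> /hasP[v vs xv] _; case/splitPr: vs => s1 s2.
(* The covector [v] is the pivot; the multiple of it subtracted from [b] is the one that makes the
   pairing with [x] vanish. *)
exists v, [seq b - (dotv x b / dotv x v) *: v | b <- s1 ++ s2]; split.
- by rewrite size_map !size_cat addnS.
- move=> _ /mapP[b _ ->].
  have -> : dotv x (b - (dotv x b / dotv x v) *: v)
            = dotv x b - (dotv x b / dotv x v) * dotv x v.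
    rewrite {1 2 5}/dotv mulr_sumr -sumrB; apply: eq_bigr => i _.
    by rewrite !mxE mulrBr mulrCA.
  by rewrite divfK // subrr.
- rewrite big_cat big_cons /= wedgeA -square_formC -(wedgeA (square_form v)).
  rewrite -big_cat big_map.
  elim: (s1 ++ s2) => [|b t IHt]; first by rewrite !big_nil.
  rewrite !big_cons (square_form_shear v b) !(square_formCA v b).
  by rewrite IHt.
Qed.

Lemma strongly_positiveZ N p k (a : extalg R N) :
  0 <= k -> strongly_positive p a -> strongly_positive p (k *: a).
Proof.
move=> k0 [m [c [F [c0 HF ->]]]]; exists m, (fun i => k * c i), F; split=> //.
  by move=> i; rewrite mulr_ge0.
by rewrite scaler_sumr; apply: eq_bigr => i _; rewrite scalerA.
Qed.

Lemma elementary_lift n p (x : 'rV[R]_n.+1) (F : extalg R n) :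
  x 0 ord0 != 0 -> elementary p F ->
  exists G, [/\ elementary p G, ladder_sum false (pairv x 0) G = 0,
    ladder_sum false (pairv 0 x) G = 0 & slice G = F].
Proof.
move=> x0 /elementaryP[s sp ->].
(* The entry of index 0 is forced by the requirement that the lifted covector vanish on [x]. *)
pose lft (a : 'rV[R]_n) : 'rV[R]_n.+1 :=
  \row_j (if unlift ord0 j is Some i then a 0 i
          else - dotv (tail_row x) a / x 0 ord0).
have tlft a : tail_row (lft a) = a.
  by apply/rowP=> i; rewrite !mxE liftK.
have xlft a : dotv x (lft a) = 0.
  rewrite /dotv big_ord_recl !mxE unlift_none mulrCA divff // mulr1.
  apply/eqP; rewrite addrC subr_eq0; apply/eqP/eq_bigr => i _.
  by rewrite !mxE liftK.
pose G := \big[@wedge R n.+1/ext1 R n.+1]_(v <- [seq lft a | a <- s])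
  square_form v.
have Gw u v :
    (forall a, dotv u (lft a) = 0) -> (forall a, dotv v (lft a) = 0) ->
    ladder_sum false (pairv u v) G = 0.
  move=> Hu Hv; rewrite -[G]wedge1r ladder_sum_square_prod ?contract_ext1
    ?linear0 //.
  by move=> _ /mapP[a _ ->].
exists G; split.
- by apply/elementaryP; exists [seq lft a | a <- s]; rewrite ?size_map.
- by apply: Gw => // a; rewrite dot0v.
- by apply: Gw => // a; rewrite dot0v.
- rewrite slice_square_prod -map_comp; congr (bigop _ _ _).
  by rewrite -[RHS]map_id; apply: eq_map => a /=; rewrite tlft.
Qed.

(** The elementary terms of the slice are lifted one by one with the same coefficients. The
    difference between [a] and the lifted sum is killed by both contractions and has zero slice, so
    it is zero. *)
Lemma strongly_positive_slice n p (x : 'rV[R]_n.+1) (a : extalg R n.+1) :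
  x 0 ord0 != 0 -> ladder_sum false (pairv x 0) a = 0 ->
  ladder_sum false (pairv 0 x) a = 0 ->
  strongly_positive p (slice a) -> strongly_positive p a.
Proof.
move=> x0 ax axi [m [c [F [c0 HF aF]]]].
have /choice[G HG] := fun k => elementary_lift x0 (HF k).
exists m, c, G; split=> // [k|]; first by have [] := HG k.
have sumE (f : {linear extalg R n.+1 -> extalg R n.+1}) :
    (forall k, f (G k) = 0) -> f (\sum_(k < m) c k *: G k) = 0.
  by move=> fG; rewrite linear_sum big1 // => k _;
    rewrite linearZ /= fG scaler0.
apply/eqP; rewrite -subr_eq0; apply/eqP/(contract_slice_inj x0).
- by rewrite linearB /= ax sumE ?subr0 // => k; have [] := HG k.
- by rewrite linearB /= axi sumE ?subr0 // => k; have [] := HG k.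
- rewrite linearB /= aF linear_sum -sumrB big1 // => k _.
  by rewrite linearZ /=; have [_ _ _ ->] := HG k; rewrite subrr.
Qed.

End Positivity.

(** * Top degree forms and weak positivity *)

Section WeakPositivity.
Context {R : realType}.

Definition basis_rows N : seq 'rV[R]_N := [seq 'e_j | j <- index_enum 'I_N].

Lemma size_basis_rows N : size (basis_rows N) = N.
Proof. by rewrite size_map -[RHS]card_ord cardE enumT. Qed.

Lemma volume_formE N : volume_form R N =
  \big[@wedge R N/ext1 R N]_(v <- basis_rows N) square_form v.
Proof.
rewrite big_map; apply: eq_bigr => j _.
have sumE (F : 'I_N -> extalg R N) :
    \sum_(i < N) ('e_j : 'rV[R]_N) 0 i *: F i = F j.
  rewrite (bigD1 j) //= mxE !eqxx scale1r big1 ?addr0 // => i /negPf ij.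
  by rewrite mxE ij andbF scale0r.
by rewrite /square_form /form10 /form10_sharp !sumE.
Qed.

Lemma bidegree_ext1 N : bidegree 0 0 (ext1 R N).
Proof.
move=> I K; rewrite /coef ffunE; case: ((I, K) =P _) => [[-> ->] _|_];
  last by rewrite eqxx.
by rewrite cards0.
Qed.

Lemma bidegree_volume_form N : bidegree N N (volume_form R N).
Proof.
rewrite volume_formE -[X in bidegree _ _ X]wedge1r.
have := @bidegree_square_prod _ _ _ _ (basis_rows N) _ (@bidegree_ext1 N).
by rewrite size_basis_rows addn0.
Qed.

Lemma bidegree_top N (a : extalg R N) : bidegree N N a ->
  a = a (finset.setT, finset.setT) *: ebasis R finset.setT finset.setT.
Proof.
move=> Ha; apply/ffunP=> -[I K]; rewrite ffunE ebasisE.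
case: eqP => [[-> ->]|IK]; first by rewrite [RHS]mulr1.
rewrite [RHS]mulr0; apply/eqP; apply: contraT => /Ha[/esym cI /esym cK].
case: IK; congr (_, _); apply/eqP; rewrite eqEcard finset.subsetT cardsT
  card_ord.
  by rewrite -cI leqnn.
by rewrite -cK leqnn.
Qed.

(** Sends top degree forms on R^(n+1) to top degree forms on R^n, the volume form going to x_0^2
    times the volume form; signs can thus be read one dimension lower. *)
Definition double_contract n (x : 'rV[R]_n.+1) (a : extalg R n.+1) :
  extalg R n :=
  slice (ladder_sum false (pairv 0 x) (ladder_sum false (pairv x 0) a)).

Lemma double_contractZ n (x : 'rV[R]_n.+1) k a :
  double_contract x (k *: a) = k *: double_contract x a.
Proof. by rewrite /double_contract !linearZ. Qed.

Lemma double_contract_volume n (x : 'rV[R]_n.+1) :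
  double_contract x (volume_form R n.+1) = x 0 ord0 ^+ 2 *: volume_form R n.
Proof.
rewrite /volume_form big_ord_recl -wedgeA.
rewrite (wedge_gen (inl ord0)) (wedge_gen (inr ord0)) /double_contract.
set V := bigop _ _ _.
have sV : slice V = volume_form R n.
  rewrite /V (big_morph _ (@slice_wedge R n) (@slice_ext1 R n)).
  apply: eq_bigr => i _; rewrite slice_wedge.
  rewrite -[dx R (lift _ _)]wedge1r -[dxi R (lift _ _)]wedge1r.
  rewrite -[dx R i]wedge1r -[dxi R i]wedge1r.
  rewrite (wedge_gen (inl (lift ord0 i))) (wedge_gen (inr (lift ord0 i))).
  rewrite (wedge_gen (inl i)) (wedge_gen (inr i)).
  rewrite (slice_ladder _ (inl i)) (slice_ladder _ (inr i)).
  by rewrite slice_ext1.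
rewrite ladder_sum_ladder mul1r linearB linearZ /=.
rewrite linearB linearZ /= slice_contract0 ?eqxx ?orbT //=.
rewrite ladder_sum_ladder /= mxE mulr0 scale0r sub0r linearN /=.
by rewrite slice_ladder0 ?eqxx // oppr0 subr0 sV scalerA.
Qed.

Lemma volume_form_neq0 N : volume_form R N != 0.
Proof.
elim: N => [|n IHn].
  rewrite /volume_form big_ord0; apply/eqP =>
    /ffunP/(_ (finset.set0, finset.set0)).
  by rewrite !ffunE eqxx => /eqP; rewrite oner_eq0.
apply: contra IHn => /eqP V0.
(* Any point with x_0 = 1 would serve here. *)
have := double_contract_volume (const_mx 1 : 'rV[R]_n.+1).
rewrite V0 /double_contract !linear0 mxE expr1n scale1r => <-; exact: eqxx.
Qed.

Lemma bidegree_top_volume N (a : extalg R N) :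
  bidegree N N a -> exists f : R, a = f *: volume_form R N.
Proof.
move=> /bidegree_top ->; have := volume_form_neq0 N.
rewrite (bidegree_top (@bidegree_volume_form N)).
set v := volume_form _ _ _; set k := a _;
  rewrite scaler_eq0 negb_or => /andP[v0 _].
by exists (k / v); rewrite scalerA divfK.
Qed.

Lemma double_contract_square n (x v : 'rV[R]_n.+1) (a : extalg R n.+1) :
  ladder_sum false (pairv x 0) a = 0 -> ladder_sum false (pairv 0 x) a = 0 ->
  double_contract x (wedge (square_form v) a) = dotv x v ^+ 2 *: slice a.
Proof.
move=> ax axi; rewrite square_formE /double_contract !ladder_sum_contract.
rewrite !sum_pairv !dot0v !dotv0 !addr0 ax linear0 scale0r (subrr 0) linear0
  subr0.
rewrite linearZ /= ladder_sum_contract sum_pairv dot0v add0r axi linear0 subr0.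
by rewrite scalerA linearZ expr2.
Qed.

Definition transpose N (a : extalg R N) : extalg R N :=
  [ffun A : {set 'I_N} * {set 'I_N} => a (A.2, A.1)].

(** Contraction in a dxi direction first crosses all the dx factors; apart from that sign the
    transposition exchanges the two contractions, hence preserves the forms killed by both. *)
Lemma transpose_contract_x N (x : 'rV[R]_N) (a : extalg R N) I K :
  ladder_sum false (pairv x 0) (transpose a) (I, K)
  = (-1) ^+ #|K| * ladder_sum false (pairv 0 x) a (K, I).
Proof.
rewrite /ladder_sum !big_sumType /= [X in _ + X]big1 ?addr0; last first.
  by move=> i _; rewrite mxE scale0r.
rewrite [X in X + _]big1 ?add0r; last by move=> i _; rewrite mxE scale0r.
rewrite !sum_ffunE mulr_sumr; apply: eq_bigr => i _.
rewrite !ffunE /=; case: ifP => _; last by rewrite !scaler0 mulr0.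
have scE (k : R) (y : R^o) : k *: y = k * y :> R by [].
by rewrite !scE exprD [RHS]mulrCA !mulrA -[X in _
  = X * _ * _]mulrA -expr2 sqrr_sign mulr1.
Qed.

Lemma transpose_contract_xi N (x : 'rV[R]_N) (a : extalg R N) I K :
  ladder_sum false (pairv 0 x) (transpose a) (I, K)
  = (-1) ^+ #|I| * ladder_sum false (pairv x 0) a (K, I).
Proof.
rewrite /ladder_sum !big_sumType /= [X in X + _]big1 ?add0r; last first.
  by move=> i _; rewrite mxE scale0r.
rewrite [X in _ + X]big1 ?addr0; last by move=> i _; rewrite mxE scale0r.
rewrite !sum_ffunE mulr_sumr; apply: eq_bigr => i _.
rewrite !ffunE /=; case: ifP => _; last by rewrite !scaler0 mulr0.
have scE (k : R) (y : R^o) : k *: y = k * y :> R by [].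
by rewrite !scE exprD [RHS]mulrCA -!mulrA.
Qed.

Lemma weakly_positive_slice n p (x : 'rV[R]_n.+1) (a : extalg R n.+1) :
  x 0 ord0 != 0 -> bidegree p p a ->
  ladder_sum false (pairv x 0) a = 0 -> ladder_sum false (pairv 0 x) a = 0 ->
  weakly_positive p (slice a) -> weakly_positive p a.
Proof.
move=> x0 pa ax axi [spa sC sF]; split=> // [I K|m F pm].
  (* Symmetry: [a - transpose a] is killed by both contractions and its slice is zero because the
     slice of [a] is symmetric. *)
  have /ffunP/(_ (I, K)) : a - transpose a = 0.
    apply: (contract_slice_inj x0).
    - rewrite linearB /= ax sub0r; apply/eqP; rewrite oppr_eq0; apply/eqP/ffunP.
      by move=> -[J L]; rewrite transpose_contract_x axi !ffunE mulr0.
    - rewrite linearB /= axi sub0r; apply/eqP; rewrite oppr_eq0;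
      apply/eqP/ffunP.
      by move=> -[J L]; rewrite transpose_contract_xi ax !ffunE mulr0.
    - apply/ffunP=> -[J L]; have := sC J L; rewrite /coef !ffunE /= => ->.
      by rewrite subrr.
  by rewrite !ffunE /coef => /eqP; rewrite subr_eq0 => /eqP.
move=> /elementaryP[s sm ->]; case: m sm pm => [|m] sm pm.
  (* Here p = n + 1 exceeds the dimension of the slice, so the slice vanishes and [a] with it. *)
  suff -> : a = 0 by rewrite wedge0l; exists 0; rewrite ?scale0r.
  apply: (contract_slice_inj x0 ax axi); apply/ffunP=> -[I K].
  rewrite [RHS]ffunE; apply/eqP; apply: contraT => /spa[cI _].
  move: pm; rewrite addn0 => pn; rewrite pn in cI.
  by have := max_card (mem I); rewrite card_ord cI ltnn.
have s0 : s != [::] by case: s sm.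
have [b [t [st tx sE]]] := square_prod_eliminate x s0.
set B := (X in wedge _ X) in sE.
have [] := @bidegree_top_volume n.+1 (wedge a (wedge (square_form b) B)).
  rewrite -sE -square_form_prodC; have := @bidegree_square_prod _ _ _ _ s _ pa.
  by rewrite sm addnC pm.
move=> g gE; rewrite sE gE; exists g => //.
(* All the factors of [B] vanish on [x], so [G] inherits from [a] the vanishing of both
   contractions. *)
pose G := wedge B a.
have GE : wedge a (wedge (square_form b) B) = wedge (square_form b) G.
  rewrite /G square_form_prodC (wedgeA a) -(square_formC b).
  by rewrite -(wedgeA (square_form b)).
have Gx : ladder_sum false (pairv x 0) G = 0.
  rewrite ladder_sum_square_prod ?ax ?linear0 // => c /tx ->; split=> //.
  exact: dot0v.
have Gxi : ladder_sum false (pairv 0 x) G = 0.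
  rewrite ladder_sum_square_prod ?axi ?linear0 // => c /tx ->; split=> //.
  exact: dot0v.
have [] := sF m (slice B).
- by move: pm; rewrite addnS => -[].
- apply/elementaryP; exists [seq tail_row b | b <- t].
    by rewrite size_map; apply/eqP; rewrite -eqSS -st sm.
  exact: slice_square_prod.
move=> f fE f0.
(* The double contraction of the same top form computed twice: from its multiple of the volume form,
   and from the factor b /\ b^#. *)
have : g * x 0 ord0 ^+ 2 = dotv x b ^+ 2 * f.
  have := double_contract_square b Gx Gxi.
  rewrite -GE gE double_contractZ double_contract_volume /G square_form_prodC.
  rewrite slice_wedge fE !scalerA => /eqP; rewrite -subr_eq0 -scalerBl.
  by rewrite scaler_eq0 (negPf (volume_form_neq0 n)) orbF subr_eq0 => /eqP.
move=> gfE; have x2 : 0 < x 0 ord0 ^+ 2 by rewrite exprn_even_gt0.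
by rewrite -(pmulr_lge0 _ x2) gfE mulr_ge0 // sqr_ge0.
Qed.

End WeakPositivity.

(** * Functions of class C^k *)

Section ContinuousPartials.
Context {R : realType}.

(** The mean value theorem between 0 and [t] for either sign of [t], with the intermediate point
    bounded in absolute value. *)
Lemma MVT_from0 (g dg : R -> R) (t : R) :
  (forall s, `|s| <= `|t| -> is_derive s (1 : R) g (dg s)) ->
  exists2 c, `|c| <= `|t| & g t - g 0 = dg c * t.
Proof.
move=> gdg; have [t0|t0] := leP 0 t.
  have ht s : s \in `[0, t] -> `|s| <= `|t|.
    by rewrite in_itv /= => /andP[s0 st]; rewrite !ger0_norm.
  have [||c /ht ct] := @MVT_segment _ g dg 0 t t0.
  - by move=> s /subset_itv_oo_cc /ht /gdg.
  - by apply: derivable_within_continuous => s /ht /gdg [].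
  - by rewrite subr0; exists c.
have ht s : s \in `[t, 0] -> `|s| <= `|t|.
  by rewrite in_itv /= => /andP[ts s0];
    rewrite (ler0_norm s0) (ler0_norm (ltW t0)) lerN2.
have [||c /ht ct] := @MVT_segment _ g dg t 0 (ltW t0).
- by move=> s /subset_itv_oo_cc /ht /gdg.
- by apply: derivable_within_continuous => s /ht /gdg [].
- by rewrite sub0r mulrN => E; exists c => //; rewrite -[RHS]opprK -E opprB.
Qed.

Lemma is_derive_line (V : normedModType R) (f : V -> R) (y v : V) (s : R) :
  derivable f (s *: v + y) v ->
  is_derive s (1 : R) (fun t : R => f (t *: v + y)) ('D_v f (s *: v + y)).
Proof.
pose g t := f (t *: v + y).
have growth : (fun h : R => h^-1 *: ((g \o shift s) (h *: 1) - g s)) =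
    (fun h => h^-1 *: ((f \o shift (s *: v + y)) (h *: v) - f (s *: v + y))).
  by apply/funext => h /=; rewrite [h *: 1]mulr1 /g scalerDl addrA.
by move=> df; split; rewrite -/g /derivable /derive growth.
Qed.

Lemma rV_norm_le N (h : 'rV[R]_N) (r : R) :
  0 <= r -> (forall j, `|h 0 j| <= r) -> `|h| <= r.
Proof.
move=> r0 hr; rewrite [`|h|]mx_normrE; apply/bigmax_leP; split=> // -[i j] _ /=.
by rewrite ord1.
Qed.

Lemma rV_norm_ge N (h : 'rV[R]_N) j : `|h 0 j| <= `|h|.
Proof.
by rewrite [leRHS]mx_normrE (le_bigmax _ (fun ij => `|h ij.1 ij.2|) (0, j)).
Qed.

(** The increment is o(h), so the differential at [a] is zero. *)
Lemma differentiable_small (V : normedModType R) (g : V -> R) (a : V) :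
  (forall e : R, 0 < e ->
     \forall h \near (0 : V), `|g (h + a) - g a| <= e * `|h|) ->
  differentiable g a.
Proof.
move=> gs.
have o0 : g \o shift a = cst (g a) + (\0 : {linear V -> R^o}) +o_ (0 : V) id.
  apply/eqaddoP => e e0; near=> h.
  rewrite !fctE /= addr0; near: h; exact: gs.
apply/diff_locallyP; rewrite (diff_unique _ o0); last exact: cst_continuous.
by split=> //; exact: cst_continuous.
Unshelve. all: by end_near. Qed.

(** The vertices of a path from 0 to [h] with one segment per coordinate direction. *)
Definition truncate N (k : nat) (h : 'rV[R]_N) : 'rV[R]_N :=
  \row_j if (j < k)%N then h 0 j else 0.

Lemma truncateS N (k : 'I_N) (h : 'rV[R]_N) :
  truncate k.+1 h = h 0 k *: 'e_k + truncate k h.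
Proof.
apply/rowP=> j; rewrite !mxE eqxx ltnS leq_eqVlt.
have [jk|jk] := eqVneq (j : nat) k.
  by rewrite jk ltnn addr0 (val_inj jk) eqxx mulr1.
by rewrite (negPf (contra_neq _ jk)) ?mulr0 ?add0r // => ->.
Qed.

(* The increment of [f] is telescoped along the coordinate directions, and the
   mean value theorem is applied on each of the [N] segments. *)
Lemma differentiable_partials N (U : set 'rV[R]_N) (f : 'rV[R]_N -> R)
    (a : 'rV[R]_N) :
  open U -> U a -> (forall j x, U x -> derivable f x 'e_j) ->
  (forall j, {for a, continuous ('D_'e_j f)}) -> differentiable f a.
Proof.
move=> oU Ua df cf.
(* The candidate differential; once it is subtracted, an o(h) increment is left. *)
pose L (x : 'rV[R]_N) := \sum_j x 0 j *: ('D_'e_j f a : R^o).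
have dL : differentiable (L : 'rV[R]_N -> R^o) a.
  have -> : L = \sum_j (fun x : 'rV[R]_N => x 0 j *: ('D_'e_j f a : R^o)).
    by apply/funext=> x; rewrite fct_sumE.
  apply: differentiable_sum => j; apply: differentiableZl.
  exact: differentiable_coord.
suff : differentiable ((f - L) + L) a by rewrite subrK.
apply: differentiableD => //; apply: differentiable_small => e e0.
(* The division by N + 1 rather than N covers N = 0; the N errors still add up to at most e times
   the norm of h. *)
pose e' := e / N.+1%:R.
have e'0 : 0 < e' by rewrite divr_gt0.
have nearU : \forall y \near a, U y by exact: open_nbhs_nbhs.
have nearD : \forall y \near a, forall j, `|'D_'e_j f a - 'D_'e_j f y| <= e'.
  refine (@filter_forall _ _ (fun j y =>
    `|'D_'e_j f a - 'D_'e_j f y| <= e') (nbhs a) _ _) => j.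
  by have /cvgrPdist_le := cf j; apply.
have [d /= d0 dP] := (nbhs_ballP _ _).1 (filterI nearU nearD).
apply/nbhs_ballP; exists d => //= h; rewrite -ball_normE /= sub0r normrN => hd.
have near_a y : `|y| <= `|h| ->
    U (y + a) /\ forall j, `|'D_'e_j f a - 'D_'e_j f (y + a)| <= e'.
  move=> yh; apply: dP; rewrite -ball_normE /= opprD addrCA subrr addr0 normrN.
  exact: le_lt_trans hd.
pose incr k := f (truncate k.+1 h + a) - f (truncate k h + a).
have step (k : 'I_N) : `|incr k - h 0 k * 'D_'e_k f a| <= e' * `|h|.
  (* In the sup norm the whole path stays within the norm of [h], hence in the neighbourhood fixed
     above. *)
  have ch c : `|c| <= `|h 0 k| -> `|c *: 'e_k + truncate k h| <= `|h|.
    move=> ch; apply: rV_norm_le => // j; rewrite !mxE eqxx.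
    have [->|jk] := eqVneq j k; last first.
      rewrite mulr0 add0r; case: ifP => _; first exact: rV_norm_ge.
      by rewrite normr0.
    by rewrite ltnn addr0 mulr1 (le_trans ch) ?rV_norm_ge.
  have [|c /ch cN] := @MVT_from0 (fun t => f (t *: 'e_k + (truncate k h + a)))
     (fun t => 'D_'e_k f (t *: 'e_k + (truncate k h + a))) (h 0 k).
    move=> s /ch /near_a[Us _]; apply: is_derive_line; apply: df.
    by rewrite addrA.
  rewrite scale0r add0r !addrA -truncateS -/(incr k) => ->.
  rewrite [h 0 k * _]mulrC -mulrBl normrM ler_pM ?rV_norm_ge //.
  by rewrite distrC; have [_] := near_a _ cN.
have telescope : f (h + a) - f a = \sum_(k < N) incr k.
  rewrite -(big_mkord predT incr).
  rewrite telescope_sumr //; congr (f (_ + a) - f _).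
    by apply/rowP=> j; rewrite mxE ltn_ord.
  by rewrite [truncate 0 h](_ : _ = 0) ?add0r //; apply/rowP=> j; rewrite !mxE.
have -> : (f - L) (h + a) - (f - L) a =
    \sum_(k < N) (incr k - h 0 k * 'D_'e_k f a).
  rewrite sumrB -telescope !fctE /L.
  under eq_bigr => j _ do rewrite mxE scalerDl.
  by rewrite big_split /=; ring.
apply: le_trans (ler_norm_sum _ _ _) _.
apply: le_trans (ler_sum _ (fun k _ => step k)) _.
rewrite sumr_const card_ord -mulr_natl mulrA ler_wpM2r //.
rewrite /e' mulrCA ger_pMr // ler_pdivrMr // mul1r ler_nat.
exact: leqnSn.
Qed.

End ContinuousPartials.

(** * Closure properties of the classes C^k *)

Section SmoothFunctions.
Context {R : realType}.

Lemma derive_sum_partials N (f : 'rV[R]_N -> R) (a v : 'rV[R]_N) :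
  differentiable f a -> 'D_v f a = \sum_j v 0 j * 'D_'e_j f a.
Proof.
move=> df; rewrite deriveE // {1}[v]row_sum_delta linear_sum.
by apply: eq_bigr => j _; rewrite linearZ deriveE.
Qed.

Lemma is_derive_coord N (x v : 'rV[R]_N) i :
  is_derive x v (fun y : 'rV[R]_N => y 0 i) (v 0 i).
Proof.
have -> : v 0 i = 'D_v (fun y : 'rV[R]_N => y 0 i) x.
  rewrite /derive; apply/esym/cvg_lim => //.
  apply: cvg_near_cst; near=> h => /=.
  rewrite !mxE addrK [_ *: _]mulrA mulVf ?mul1r //.
  by near: h; exact: nbhs_dnbhs_neq.
exact/derivableP/diff_derivable/differentiable_coord.
Unshelve. all: by end_near. Qed.

Context {N : nat} {U : set 'rV[R]_N}.
Context (oU : open U).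
Implicit Types f g : 'rV[R]_N -> R.

Lemma near_open (x : 'rV[R]_N) : U x -> \forall y \near x, U y.
Proof. by move=> Ux; exact: open_nbhs_nbhs. Qed.

Lemma is_Ck_continuous k f : is_Ck k U f -> forall x, U x -> {for x, continuous
  f}.
Proof. by case: k => [|k] []. Qed.

Lemma is_CkS k f : is_Ck k.+1 U f -> is_Ck k U f.
Proof.
elim: k f => [|k IHk] f [cf Df]; first by split.
by split=> // j; have [df /IHk] := Df j.
Qed.

(** [is_Ck] only speaks of partial derivatives; the chain rule and the directional derivatives below
    require a true differential. *)
Lemma is_C1_differentiable k f x : is_Ck k.+1 U f -> U x -> differentiable f x.
Proof.
move=> [cf Df] Ux; apply: (differentiable_partials oU Ux) => j.
  by move=> y Uy; have [+ _] := Df j; apply.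
by have [_ /is_Ck_continuous] := Df j; apply.
Qed.

Lemma near_open_eq f g x : (forall x, U x -> f x = g x) -> U x ->
  \forall y \near x, f y = g y.
Proof. by move=> fg /near_open; apply: filterS => y; exact: fg. Qed.

Lemma continuous_open_ext f g x : (forall x, U x -> f x = g x) -> U x ->
  {for x, continuous f} -> {for x, continuous g}.
Proof.
move=> fg Ux cf; rewrite /prop_for /continuous_at -(fg _ Ux).
apply: cvg_trans cf.
exact: (@near_eq_cvg _ _ (nbhs x) _ _ _ (near_open_eq fg Ux)).
Qed.

Lemma is_Ck_ext k f g : (forall x, U x -> f x
  = g x) -> is_Ck k U f -> is_Ck k U g.
Proof.
elim: k f g => [|k IHk] f g fg [cf Df].
  by split=> // x Ux; exact: continuous_open_ext (cf _ Ux).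
split; first by move=> x Ux; exact: continuous_open_ext (cf _ Ux).
move=> j; have [df Cf] := Df j; split.
  move=> x Ux; apply: near_eq_derivable (df _ Ux); exact: near_open_eq.
apply: IHk Cf => x Ux; apply: near_eq_derive; exact: near_open_eq.
Qed.

Lemma is_Ck_cst k (c : R) : is_Ck k U (fun=> c).
Proof.
elim: k c => [|k IHk] c; first by split=> // x _; exact: cst_continuous.
split=> [x _|j]; first exact: cst_continuous.
split=> [x _|]; first exact: derivable_cst.
by apply: is_Ck_ext (IHk 0) => x _; rewrite derive_cst.
Qed.

Lemma is_Ck_coord k i : is_Ck k U (fun x : 'rV[R]_N => x 0 i).
Proof.
case: k => [|k]; first by split=> // x _; exact: coord_continuous.
split=> [x _|j]; first exact: coord_continuous.
split=> [x _|]; first exact/diff_derivable/differentiable_coord.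
apply: is_Ck_ext (is_Ck_cst k (('e_j : 'rV[R]_N) 0 i)) => x _.
by rewrite (@derive_val _ _ _ _ _ _ _ (is_derive_coord x 'e_j i)).
Qed.

Lemma is_CkD k f g : is_Ck k U f -> is_Ck k U g -> is_Ck k U (fun x =>
  f x + g x).
Proof.
elim: k f g => [|k IHk] f g [cf Df] [cg Dg].
  by split=> // x Ux; apply: continuousD; [exact: cf | exact: cg].
split; first by move=> x Ux; apply: continuousD; [exact: cf | exact: cg].
move=> j; have [df Cf] := Df j; have [dg Cg] := Dg j; split.
  by move=> x Ux; apply: derivableD; [exact: df | exact: dg].
apply: is_Ck_ext (IHk _ _ Cf Cg) => x Ux.
by rewrite -deriveD; [|exact: df|exact: dg].
Qed.

Lemma is_Ck_sum (I : Type) (r : seq I) k (F : I -> 'rV[R]_N -> R) :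
  (forall i, is_Ck k U (F i)) -> is_Ck k U (fun x => \sum_(i <- r) F i x).
Proof.
move=> CF; elim: r => [|i r IHr].
  by apply: is_Ck_ext (is_Ck_cst k 0) => x _; rewrite big_nil.
by apply: is_Ck_ext (is_CkD (CF i) IHr) => x _; rewrite big_cons.
Qed.

Lemma is_CkM k f g : is_Ck k U f -> is_Ck k U g -> is_Ck k U (fun x =>
  f x * g x).
Proof.
elim: k f g => [|k IHk] f g Cf Cg.
  by split=> // x Ux; apply: continuousM;
    [exact: is_Ck_continuous Cf _ Ux|exact: is_Ck_continuous Cg _ Ux].
split; first by move=> x Ux; apply: continuousM;
  [exact: is_Ck_continuous Cf _ Ux|exact: is_Ck_continuous Cg _ Ux].
move=> j; have [_ /(_ j)[df Dfk]] := Cf; have [_ /(_ j)[dg Dgk]] := Cg; split.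
  by move=> x Ux; apply: derivableM; [exact: df | exact: dg].
apply: is_Ck_ext (is_CkD (IHk _ _ (is_CkS Cf) Dgk) (IHk _ _ (is_CkS Cg) Dfk)).
by move=> x Ux; rewrite -[RHS]/('D_'e_j (f * g) x) deriveM;
  [|exact: df|exact: dg].
Qed.

Lemma is_CkV k f : (forall x, U x -> f x != 0) -> is_Ck k U f ->
  is_Ck k U (fun x => (f x)^-1).
Proof.
move=> f0; elim: k => [|k IHk] Cf.
  split=> // x Ux; apply: continuousV;
    [exact: f0|exact: is_Ck_continuous Cf _ Ux].
split.
  by move=> x Ux; apply: continuousV;
    [exact: f0|exact: is_Ck_continuous Cf _ Ux].
have CV := IHk (is_CkS Cf).
move=> j; have [_ /(_ j)[df Dfk]] := Cf; split.
  by move=> x Ux; apply: derivableV; [exact: f0|exact: df].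
(* The partial derivative is -(1/f)(1/f) f', where 1/f is already of class C^k by induction. *)
apply: is_Ck_ext (is_CkM (is_Ck_cst k (-1)) (is_CkM (is_CkM CV CV) Dfk)).
move=> x Ux; rewrite deriveV; [|exact: f0|exact: df].
by rewrite mulN1r -expr2 -exprVn -mulNr.
Qed.

Lemma continuous_coordinates m (phi : 'rV[R]_N -> 'rV[R]_m) (x : 'rV[R]_N) :
  (forall i, {for x, continuous (fun y =>
    phi y 0 i)}) -> {for x, continuous phi}.
Proof.
move=> cphi; apply: (cvgrPdist_le (FF := nbhs_filter x) _ _).2 => e e0.
have : \forall y \near x, forall i, `|phi x 0 i - phi y 0 i| <= e.
  refine (@filter_forall _ _ (fun i y =>
    `|phi x 0 i - phi y 0 i| <= e) (nbhs x) _ _) => i.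
  by have /cvgrPdist_le := cphi i; apply.
apply: filterS => y xy; apply: rV_norm_le; first exact: ltW.
by move=> i; rewrite !mxE.
Qed.

Lemma differentiable_coordinates m (phi : 'rV[R]_N -> 'rV[R]_m) (x : 'rV[R]_N) :
  (forall i, differentiable (fun y => phi y 0 i) x) -> differentiable phi x.
Proof.
move=> dphi.
have -> : phi = \sum_i (fun x : 'rV[R]_N => phi x 0 i *: ('e_i : 'rV[R]_m)).
  by apply/funext=> y; rewrite fct_sumE -row_sum_delta.
by apply: differentiable_sum => i; apply: differentiableZl.
Qed.

End SmoothFunctions.

(** Induction on k: the chain rule writes each partial derivative as a sum of products of C^k
    functions, the induction hypothesis being applied to the partial derivatives of [f]. *)
Lemma is_Ck_comp (R : realType) N m k (U : set 'rV[R]_N) (f : 'rV[R]_m -> R)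
    (phi : 'rV[R]_N -> 'rV[R]_m) :
  open U -> is_Ck k setT f -> (forall i, is_Ck k U (fun x => phi x 0 i)) ->
  is_Ck k U (f \o phi).
Proof.
move=> oU; elim: k f => [|k IHk] f Cf Cphi.
  split=> // x Ux; apply: continuous_comp.
    by apply: continuous_coordinates => i;
      exact: is_Ck_continuous (Cphi i) _ Ux.
  by case: Cf => cf _; exact: cf.
have dphi x : U x -> differentiable phi x.
  by move=> Ux; apply: differentiable_coordinates => i;
    exact: (@is_C1_differentiable _ _ _ oU _ _ _ (Cphi i) Ux).
have df y : differentiable f y.
  exact: (@is_C1_differentiable _ _ _ openT _ _ _ Cf I).
have dfphi x : U x -> differentiable (f \o phi) x.
  by move=> Ux; apply: differentiable_comp; [exact: dphi|exact: df].
split; first by move=> x /dfphi; exact: differentiable_continuous.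
move=> j; split; first by move=> x /dfphi; exact: diff_derivable.
have Cpartial : is_Ck k U (fun x =>
    \sum_i ('D_'e_i f \o phi) x * 'D_'e_j (fun y => phi y 0 i) x).
  apply: (is_Ck_sum oU) => i; apply: (is_CkM oU).
    by apply: IHk => [|l]; [have [_ /(_ i)[]] := Cf|exact/is_CkS/Cphi].
  by have [_ /(_ j)[]] := Cphi i.
apply: (is_Ck_ext oU) Cpartial => x Ux.
rewrite (deriveE _ (dfphi x Ux)) (diff_comp (dphi x Ux) (df (phi x))).
rewrite -[RHS]/('d f (phi x) ('d phi x 'e_j)) -(deriveE _ (dphi x Ux)).
rewrite -(deriveE _ (df (phi x))) (derive_sum_partials _ (df (phi x))).
have phi'x : derivable phi x 'e_j by exact/diff_derivable/dphi.
apply: eq_bigr => i _.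
have /(congr1 (fun M : 'rV[R]_m => M 0 i)) := derive_mx phi'x.
by move=> ->; rewrite mxE [RHS]mulrC.
Qed.

(** * Homogeneous superforms *)

Section SuperformCalculus.
Context {R : realType} {N : nat}.
Implicit Types (alpha : superform R N) (x v : 'rV[R]_N).

Definition partialv v alpha : superform R N :=
  fun x => [ffun A => 'D_v (fun y => alpha y A) x].

Lemma partialE j alpha x : partial j alpha x = partialv 'e_j alpha x.
Proof.
rewrite [RHS]extalg_ebasis /partial pair_bigA; apply: eq_bigr => -[I K] _ /=.
by rewrite ffunE.
Qed.

Lemma extdE alpha x :
  extd alpha x = \sum_j ladder true (inl j) (partialv 'e_j alpha x).
Proof. by apply: eq_bigr => j _; rewrite partialE -wedge_gen. Qed.

Lemma ladder_sum_unit_x e j (a : extalg R N) :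
  ladder_sum e (pairv 'e_j 0) a = ladder e (inl j) a.
Proof.
rewrite ladderE; apply: ladder_sum_eqw => -[] i /=; rewrite mxE //.
Qed.

Lemma ladder_sum_unit_xi e j (a : extalg R N) :
  ladder_sum e (pairv 0 'e_j) a = ladder e (inr j) a.
Proof.
rewrite ladderE; apply: ladder_sum_eqw => -[] i /=; rewrite mxE //.
Qed.

Lemma superTE alpha x :
  superT alpha x = \sum_j ladder true (inl j) (ladder false (inr j) (alpha x)).
Proof.
apply: eq_bigr => j _; rewrite (wedge_gen (inl j)) contractionE.
by rewrite ladder_sum_unit_xi.
Qed.

Lemma is_derive_bigsum (I : Type) (r : seq I) (F : I -> 'rV[R]_N -> R)
    (dF : I -> R) x v :
  (forall i, is_derive x v (F i) (dF i)) ->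
  is_derive x v (fun y => \sum_(i <- r) F i y) (\sum_(i <- r) dF i).
Proof.
move=> HF; elim: r => [|i r IHr].
  rewrite big_nil; have -> : (fun y => \sum_(i <- [::]) F i y) = cst 0.
    by apply/funext=> y; rewrite big_nil.
  exact: is_derive_cst.
rewrite big_cons; have -> : (fun y => \sum_(j <- i :: r) F j y)
    = F i + (fun y => \sum_(j <- r) F j y).
  by apply/funext=> y; rewrite big_cons.
exact: is_deriveD.
Qed.

Lemma is_derive_ladder e g alpha (a' : extalg R N) x v A :
  (forall A, is_derive x v (fun y => alpha y A) (a' A)) ->
  is_derive x v (fun y => ladder e g (alpha y) A) (ladder e g a' A).
Proof.
move=> Ha; rewrite ffunE; case: ifP => occ.
  have -> : (fun y => ladder e g (alpha y) A) =
      (-1) ^+ prior g A *: (fun y => alpha y (flip g A) : R).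
    by apply/funext=> y; rewrite ffunE occ.
  exact: is_deriveZ.
have -> : (fun y => ladder e g (alpha y) A) = cst 0.
  by apply/funext=> y; rewrite ffunE occ.
exact: is_derive_cst.
Qed.

Lemma is_derive_ladder_sum e (w : 'rV[R]_N -> 'I_N + 'I_N -> R) w' alpha
    (a' : extalg R N) x v A :
  (forall g, is_derive x v (w^~ g) (w' g)) ->
  (forall A, is_derive x v (fun y => alpha y A) (a' A)) ->
  is_derive x v (fun y => ladder_sum e (w y) (alpha y) A)
    ((ladder_sum e w' (alpha x) + ladder_sum e (w x) a') A).
Proof.
move=> Hw Ha; rewrite /ladder_sum -big_split sum_ffunE.
have -> : (fun y => (\sum_g w y g *: ladder e g (alpha y)) A)
    = (fun y => \sum_g (w y g * ladder e g (alpha y) A)).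
  by apply/funext=> y; rewrite sum_ffunE; apply: eq_bigr => g _; rewrite ffunE.
apply: is_derive_bigsum => g.
apply: is_derive_eq; first exact: (is_deriveM (Hw g) (is_derive_ladder e g A
  Ha)).
by rewrite !ffunE addrC; congr (_ + _); rewrite [LHS]mulrC.
Qed.

Definition differentiable_form alpha x :=
  forall A, differentiable (fun y => alpha y A) x.

Lemma differentiable_form_is_derive alpha x v : differentiable_form alpha x ->
  forall A, is_derive x v (fun y => alpha y A) (partialv v alpha x A).
Proof. by move=> da A; rewrite ffunE; exact/derivableP/diff_derivable. Qed.

(** The identity [w0] holds near [x], so it may be differentiated along [v]; Leibniz' rule gives two
    terms with sum zero. *)
Lemma contract_partial (U : set 'rV[R]_N) w w' alpha x v :
  open U -> U x -> (forall y, U y -> ladder_sum false (w y) (alpha y) = 0) ->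
  (forall g, is_derive x v (w^~ g) (w' g)) -> differentiable_form alpha x ->
  ladder_sum false (w x) (partialv v alpha x) = - ladder_sum false w' (alpha x).
Proof.
move=> oU Ux w0 Hw da; apply/eqP; rewrite -addr_eq0 addrC; apply/eqP/ffunP => A.
have H := is_derive_ladder_sum false A Hw (differentiable_form_is_derive v da).
rewrite -(derive_val (is_derive := H)) ffunE -(derive_cst (0 : R) x v).
apply: near_eq_derive; have := near_open oU Ux; apply: filterS => y Uy.
by rewrite w0 // ffunE.
Qed.

Lemma is_derive_pair_x x v g : is_derive x v (fun y =>
  pairv y 0 g) (pairv v 0 g).
Proof.
by case: g => i /=; [exact: is_derive_coord|rewrite mxE; exact: is_derive_cst].
Qed.

Lemma is_derive_pair_xi x v g : is_derive x v (fun y =>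
  pairv 0 y g) (pairv 0 v g).
Proof.
by case: g => i /=; [rewrite mxE; exact: is_derive_cst|exact: is_derive_coord].
Qed.

(* Pullback by (x, xi) |-> (l x, xi), which scales the dx_i only. *)
Definition dilate (l : R) (a : extalg R N) : extalg R N :=
  [ffun A => a A * l ^+ #|A.1|].

Lemma dilate_is_linear l : linear (dilate l).
Proof. by move=> k a b; apply/ffunP=> A; rewrite !ffunE mulrDl scalerAl. Qed.

HB.instance Definition _ l :=
  GRing.isLinear.Build R (extalg R N) (extalg R N) *:%R (dilate l)
    (dilate_is_linear l).

Lemma dilate_creation_x l i a :
  dilate l (ladder true (inl i) a) = l *: ladder true (inl i) (dilate l a).
Proof.
apply/ffunP=> A; rewrite !ffunE /=; case: eqP => iA;
  last by rewrite mul0r scaler0.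
rewrite toggle_in // (cardsD1 i A.1) iA exprS.
by rewrite [RHS]mulrCA -!mulrA; congr (_ * _); rewrite [LHS]mulrCA.
Qed.

Lemma dilate_ladder_xi l e i a :
  dilate l (ladder e (inr i) a) = ladder e (inr i) (dilate l a).
Proof.
apply/ffunP=> A; rewrite !ffunE /=; case: eqP => iA; last by rewrite mul0r.
by rewrite mulrA.
Qed.

Lemma dilate_bidegree l p q a : bidegree p q a -> dilate l a = l ^+ p *: a.
Proof.
move=> pa; apply/ffunP=> -[I K]; rewrite !ffunE /=.
have [a0|/pa[-> _]] := eqVneq (coef a I K) 0; last by rewrite mulrC.
by rewrite -[a _]/(coef a I K) a0 mul0r scaler0.
Qed.

End SuperformCalculus.

(** * Homogeneity, uniqueness and construction of the extension *)

Section ConicForms.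
Context {R : realType} {n : nat}.
Implicit Types (alpha beta : superform R n.+1) (x v : 'rV[R]_n.+1) (y :
  'rV[R]_n).

Local Notation U := (@halfspace R n).

Lemma open_halfspace : open U.
Proof.
have -> : U = ((fun x : 'rV[R]_n.+1 => x 0 ord0) @^-1` [set t | 0 < t])%classic.
  by apply/funext.
apply: open_comp; last exact: open_gt.
by move=> x _; exact: coord_continuous.
Qed.

(** The integrated form of L_E alpha = 0, with l in the role of e^t. *)
Definition homogeneous alpha := forall x l, U x -> 0 < l ->
  dilate l (alpha (l *: x)) = alpha x.

Lemma halfspaceZ x l : U x -> 0 < l -> U (l *: x).
Proof. by rewrite /halfspace => x0 l0; rewrite mxE mulr_gt0. Qed.

(** The point where the ray through x meets H_0, in the coordinates of H_0. *)
Definition proj x : 'rV[R]_n := (x 0 ord0)^-1 *: tail_row x.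

Lemma projZ x l : l != 0 -> proj (l *: x) = proj x.
Proof.
move=> l0; apply/rowP=> i; rewrite !mxE invfM mulrACA [l^-1 * _]mulVf ?mul1r //.
Qed.

Lemma inclH0_proj x : U x -> inclH0 (proj x) = (x 0 ord0)^-1 *: x.
Proof.
move=> x0; apply/rowP=> j; rewrite !mxE; case: unliftP => [i|] ->.
  by rewrite !mxE.
by rewrite mulVf // gt_eqF.
Qed.

Lemma inclH0_0 y : inclH0 y 0 ord0 = 1.
Proof. by rewrite mxE unlift_none. Qed.

Lemma halfspace_inclH0 y : U (inclH0 y).
Proof. by rewrite /halfspace inclH0_0. Qed.

Lemma proj_inclH0 y : proj (inclH0 y) = y.
Proof. by apply/rowP=> i; rewrite !mxE unlift_none liftK invr1 mul1r. Qed.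

Definition conic alpha := [/\ homogeneous alpha,
  forall x, U x -> ladder_sum false (pairv x 0) (alpha x) = 0 &
  forall x, U x -> ladder_sum false (pairv 0 x) (alpha x) = 0].

(** At the point of H_0 on the ray through x, [contract_slice_inj] applies to the difference;
    homogeneity carries the equality back to x. *)
Lemma conic_ext alpha beta : conic alpha -> conic beta ->
  (forall y, slice (alpha (inclH0 y)) = slice (beta (inclH0 y))) ->
  forall x, U x -> alpha x = beta x.
Proof.
move=> [ha ax axi] [hb bx bxi] sab x Ux.
have l0 : 0 < (x 0 ord0)^-1 by rewrite invr_gt0.
rewrite -(ha x _ Ux l0) -(hb x _ Ux l0) -inclH0_proj //; congr dilate.
set z := inclH0 _; have Uz : U z by exact: halfspace_inclH0.
apply/eqP; rewrite -subr_eq0; apply/eqP/(@contract_slice_inj _ _ z).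
- by rewrite inclH0_0 oner_eq0.
- by rewrite linearB /= ax // bx // subrr.
- by rewrite linearB /= axi // bxi // subrr.
- by rewrite linearB /= sab subrr.
Qed.

Lemma conic0 : conic (fun=> 0).
Proof. by split=> [x l _ _|x _|x _]; rewrite linear0. Qed.

Lemma flow_pullbackE (t : R) alpha x :
  flow_pullback t alpha x = dilate (expR t) (alpha (expR t *: x)).
Proof.
rewrite [RHS]extalg_ebasis /flow_pullback pair_bigA;
  apply: eq_bigr => -[I K] _ /=.
by rewrite ffunE.
Qed.

Lemma homogeneous_lieE alpha : homogeneous alpha -> is_lieE U alpha (fun=> 0).
Proof.
move=> ha x Ux I K.
have -> : (fun t => coef (flow_pullback t alpha x) I K)
  = cst (coef (alpha x) I K).
  by apply/funext=> t; rewrite flow_pullbackE ha ?expR_gt0.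
by rewrite /coef ffunE; exact: is_derive_cst.
Qed.

(** By the group law of the flow, the derivative at time s is a multiple of the derivative at time 0
    taken at the point e^s x, so it vanishes for every s. The pulled back coefficient is therefore
    constant; its values at ln l and 0 are compared. *)
Lemma lieE_homogeneous alpha : is_lieE U alpha (fun=> 0) -> homogeneous alpha.
Proof.
move=> la x l Ux l0; apply/ffunP=> -[I K].
pose c z (t : R) := coef (flow_pullback t alpha z) I K.
have cE z s t : c z (s + t) = expR s ^+ #|I| * c (expR s *: z) t.
  rewrite /c !flow_pullbackE /coef !ffunE /= expRD scalerA [expR t * _]mulrC.
  by rewrite exprMn mulrCA.
have dc s : is_derive s (1 : R) (c x) 0.
  have Us : U (expR s *: x) by apply: halfspaceZ => //; exact: expR_gt0.
  have -> : c x = expR s ^+ #|I| \*: ((c (expR s *: x) :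
    R -> R) \o shift (- s)).
    by apply/funext=> t /=; rewrite -[t in LHS](subrK s) addrC cE.
  have := la _ Us I K; rewrite /coef ffunE -/(c _) => d0.
  have d1 : is_derive (s - s) (1 : R) (c (expR s *: x)) 0 by rewrite subrr.
  have := is_deriveZ (expR s ^+ #|I|) (@is_derive1_comp _ _ (shift (- s)) s _ _
    d1 (is_derive_shift s 1 (- s))).
  by rewrite mul0r scaler0.
have := is_derive_0_is_cst (ln l) 0 dc.
by rewrite /c !flow_pullbackE lnK ?posrE // expR0 scale1r /coef !ffunE expr1n
  mulr1.
Qed.

Lemma is_extensionE p q (alpha : superform R n) omega :
  is_extension p q alpha omega <->
  [/\ has_bidegree p q U omega, conic omega &
      forall y, slice (omega (inclH0 y)) = alpha y].
Proof.
split=> [[pq ro lo ox oxi]|[pq [ho ox oxi] ro]].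
  split=> //; last by move=> y; rewrite -restrictH0E.
  split; first exact: lieE_homogeneous.
    by move=> x Ux; have := ox x Ux; rewrite /delta contractionE.
  by move=> x Ux; have := oxi x Ux; rewrite /delta_sharp contractionE.
split=> //.
- by move=> y; rewrite restrictH0E.
- exact: homogeneous_lieE.
- by move=> x Ux; rewrite /delta contractionE ox.
- by move=> x Ux; rewrite /delta_sharp contractionE oxi.
Qed.

(** In the exponent, p compensates the dilation of the dx factors and 2 the factor x_0^2 contained
    in [cone]. *)
Definition form_extension (p : nat) (alpha : superform R n) :
  superform R n.+1 :=
  fun x => (x 0 ord0)^-1 ^+ (p + 2) *: cone x (alpha (proj x)).

Lemma slice_form_extension p (alpha : superform R n) x : U x ->
  slice (form_extension p alpha x) = (x 0 ord0)^-1 ^+ p *: alpha (proj x).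
Proof.
move=> Ux; have x0 : x 0 ord0 != 0 by rewrite gt_eqF.
rewrite /form_extension linearZ /= slice_cone scalerA exprD -mulrA.
by rewrite -exprMn mulVf ?expr1n ?mulr1.
Qed.

Lemma dilate_cone l x (c : extalg R n) p q : l != 0 -> bidegree p q c ->
  dilate l (cone (l *: x) c) = l ^+ (p + 2) *: cone x c.
Proof.
move=> l0 pc; rewrite (@dilate_bidegree _ _ _ p q); last exact: bidegree_cone.
have scx (a : extalg R n.+1) : ladder_sum false (pairv (l *: x) 0) a
    = l *: ladder_sum false (pairv x 0) a.
  rewrite /ladder_sum scaler_sumr; apply: eq_bigr => -[] i _ /=.
    by rewrite mxE scalerA.
  by rewrite mxE scale0r scaler0.
have scxi (a : extalg R n.+1) : ladder_sum false (pairv 0 (l *: x)) a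
    = l *: ladder_sum false (pairv 0 x) a.
  rewrite /ladder_sum scaler_sumr; apply: eq_bigr => -[] i _ /=.
    by rewrite mxE scale0r scaler0.
  by rewrite mxE scalerA.
by rewrite /cone scx scxi !linearZ /= !scalerA exprD expr2 (mulrC (l * l)).
Qed.

Lemma form_extensionP p q (alpha : superform R n) :
  has_bidegree p q setT alpha ->
  is_extension p q alpha (form_extension p alpha).
Proof.
move=> pq; apply/is_extensionE; split.
- by move=> x _; apply/bidegreeZ/bidegree_cone/pq.
- split=> [x l Ux l0|x _|x _]; rewrite /form_extension.
  + have ln0 : l != 0 by rewrite gt_eqF.
    rewrite linearZ /= projZ // (@dilate_cone _ _ _ p q) //; last exact: pq.
    rewrite scalerA mxE invfM exprMn mulrAC -exprMn mulVf // expr1n mul1r //.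
  + by rewrite linearZ /= cone_contract_x scaler0.
  + by rewrite linearZ /= cone_contract_xi scaler0.
- move=> y; rewrite slice_form_extension ?inclH0_0;
  last exact: halfspace_inclH0.
  by rewrite invr1 expr1n scale1r proj_inclH0.
Qed.

(** The coefficients are built from 1/x_0, the coordinates and the coefficients of [alpha] composed
    with [proj], by operations that preserve C^k on the half-space. *)
Lemma smooth_form_extension p (alpha : superform R n) :
  smooth_superform setT alpha -> smooth_superform U (form_extension p alpha).
Proof.
move=> sa I K k.
have x0V : is_Ck k U (fun x => (x 0 ord0)^-1).
  apply: (is_CkV open_halfspace) => [x Ux|]; first by rewrite gt_eqF.
  exact: (is_Ck_coord open_halfspace).
have powV m : is_Ck k U (fun x => (x 0 ord0)^-1 ^+ m).
  elim: m => [|m IHm].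
    by apply: (is_Ck_ext open_halfspace) (is_Ck_cst open_halfspace k 1) => x _.
  apply: (is_Ck_ext open_halfspace) (is_CkM open_halfspace x0V IHm) => x _.
  by rewrite exprS.
have smooth_ladder e g (f : superform R n.+1) :
  (forall A, is_Ck k U (fun x => f x A)) ->
    forall A, is_Ck k U (fun x => ladder e g (f x) A).
  move=> Cf A; case: (boolP (occupied g A == e)) => occ.
    apply: (is_Ck_ext open_halfspace)
      (is_CkM open_halfspace (is_Ck_cst open_halfspace k ((-1) ^+ prior g A))
        (Cf (flip g A))) => x _.
    by rewrite ffunE occ.
  apply: (is_Ck_ext open_halfspace) (is_Ck_cst open_halfspace k 0) => x _.
  by rewrite ffunE (negPf occ).
have smooth_sum e (w : 'rV[R]_n.+1 -> 'I_n.+1 + 'I_n.+1 -> R)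
      (f : superform R n.+1) :
    (forall g, is_Ck k U (w^~ g)) -> (forall A, is_Ck k U (fun x => f x A)) ->
    forall A, is_Ck k U (fun x => ladder_sum e (w x) (f x) A).
  move=> Cw Cf A; apply: (is_Ck_ext open_halfspace)
    (is_Ck_sum open_halfspace (index_enum _) (fun g =>
      is_CkM open_halfspace (Cw g) (smooth_ladder e g f Cf A))) => x _.
  by rewrite sum_ffunE; apply: eq_bigr => g _; rewrite [RHS]ffunE.
have Cproj A : is_Ck k U (fun x => alpha (proj x) A).
  case: A => J L; apply: (is_Ck_comp open_halfspace (sa J L k)) => i.
  apply: (is_Ck_ext open_halfspace) (is_CkM open_halfspace x0V (is_Ck_coord
    open_halfspace k (lift ord0 i))) => x _.
  by rewrite !mxE.
have Cun A : is_Ck k U (fun x => unslice (alpha (proj x)) A).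
  case: (boolP ((ord0 \in A.1) || (ord0 \in A.2))) => A0.
    apply: (is_Ck_ext open_halfspace) (is_Ck_cst open_halfspace k 0) => x _.
    by rewrite ffunE A0.
  apply: (is_Ck_ext open_halfspace) (Cproj _) => x _.
  by rewrite [RHS]ffunE (negPf A0).
have Cpx g : is_Ck k U (fun x => pairv x 0 g).
  case: g => i; first exact: (is_Ck_coord open_halfspace).
  apply: (is_Ck_ext open_halfspace) (is_Ck_cst open_halfspace k 0) => x _.
  by rewrite /= mxE.
have Cpxi g : is_Ck k U (fun x => pairv 0 x g).
  case: g => i; last exact: (is_Ck_coord open_halfspace).
  apply: (is_Ck_ext open_halfspace) (is_Ck_cst open_halfspace k 0) => x _.
  by rewrite /= mxE.
have Ccone := smooth_sum false _ _ Cpx (smooth_ladder true (inl ord0) _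
  (smooth_sum false _ _ Cpxi (smooth_ladder true (inr ord0) _ Cun))) (I, K).
apply: (is_Ck_ext open_halfspace) (is_CkM open_halfspace (powV (p + 2)) Ccone)
  => x _.
by rewrite /coef [RHS]ffunE.
Qed.

End ConicForms.

(** * Derivatives of homogeneous forms and Euler's identity *)

Section ExteriorDerivative.
Context {R : realType} {n : nat}.
Implicit Types (alpha beta : superform R n.+1) (x v : 'rV[R]_n.+1) (y :
  'rV[R]_n).

Local Notation U := (@halfspace R n).

Lemma partial_homogeneous alpha x l v : homogeneous alpha -> U x -> 0 < l ->
  differentiable_form alpha (l *: x) ->
  l *: dilate l (partialv v alpha (l *: x)) = partialv v alpha x.
Proof.
move=> ha Ux l0 da; apply/ffunP=> A; rewrite !ffunE.
set f := fun z => alpha z A; set k := l ^+ #|A.1|.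
have df : differentiable (f \o *:%R l) x.
  by apply: differentiable_comp; [exact: ex_diff|exact: da].
have dk : is_derive x v (k \*: (f \o *:%R l)) (k *: (l * 'D_v f (l *: x))).
  apply: is_deriveZ; apply: DeriveDef; first exact: diff_derivable.
  rewrite (deriveE _ df) diff_comp; [|exact: ex_diff|exact: da].
  rewrite /= (@diff_val _ _ _ _ _ _ _ (is_diff_scaler l x)) linearZ /=.
  by rewrite -(deriveE _ (da A)).
rewrite [RHS](_ : _ = k *: (l * 'D_v f (l *: x))); last first.
  rewrite -(derive_val (is_derive := dk)); apply: near_eq_derive.
  have := near_open (@open_halfspace R n) Ux; apply: filterS => z Uz /=.
  by rewrite /f -(ha z l Uz l0) ffunE mulrC.
have scE (c : R) (z : R^o) : c *: z = c * z :> R by [].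
by rewrite !scE [RHS]mulrCA; congr (_ * _); exact: mulrC.
Qed.

(** A coefficient of dx_I /\ dxi_K is homogeneous of degree -|I|. Its value at (h + 1)x times (h +
    1)^|I| is constant for h near 0, and is differentiated at h = 0. *)
Lemma euler alpha x A : homogeneous alpha -> U x -> differentiable_form alpha x
  ->
  partialv x alpha x A = - (#|A.1|%:R * alpha x A).
Proof.
move=> ha Ux da; rewrite ffunE; set f := fun z => alpha z A; set p := #|A.1|.
have dF : is_derive (0 : R) (1 : R) (fun h : R => f (h *: x + x)) ('D_x f x).
  have := @is_derive_line _ _ f x x 0; rewrite scale0r add0r; apply.
  exact/diff_derivable/da.
have d1 : is_derive (0 : R) (1 : R) (shift (1 : R)) 1 by exact: is_derive_shift.
have dG := is_deriveX p d1.
have dFG := is_deriveM dF dG.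
have cF : \forall h \near (0 : R),
    ((fun h : R => f (h *: x + x)) * shift (1 : R) ^+ p) h = cst (alpha x A) h.
  near=> h; have h1 : 0 < h + 1.
    have : - h < 1 by near: h; apply: Nlt_nbhsl; rewrite oppr0 ltr01.
    by rewrite -subr_gt0 opprK addrC.
  rewrite /cst -(ha x _ Ux h1) [RHS]ffunE scalerDl scale1r.
  by rewrite mulrfctE exprfctE /= /f.
have := @near_eq_derive _ R R _ _ 0 1 cF; rewrite derive_cst.
rewrite (@derive_val _ _ _ _ _ _ _ dFG) exprfctE /= scale0r !add0r !expr1n
  scale1r mulr1.
by move=> /eqP; rewrite addrC addr_eq0 => /eqP ->; rewrite [_%:A]mulr1;
  congr (- _); exact: mulrC.
Unshelve. all: by end_near. Qed.

(** The number operator of the dx factors: removing and recreating dx_j fixes the monomials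
    containing it and kills the others. *)
Lemma number_op (a : extalg R n) A :
  (\sum_j ladder true (inl j) (ladder false (inl j) a)) A = #|A.1|%:R * a A.
Proof.
rewrite sum_ffunE -sum1_card natr_sum mulr_suml [RHS]big_mkcond.
apply: eq_bigr => j _; rewrite ffunE [occupied _ _]/= eqb_id.
case: ifP => jA; last by [].
rewrite ffunE occupied_flip eqxx [occupied _ _]/= jA flipK sign_prior_flip.
by rewrite precedesxx mulr1 mulrA -expr2 sqrr_sign.
Qed.

End ExteriorDerivative.

(** * Contraction, restriction and homogeneity of d and T *)

Section ConicDerivative.
Context {R : realType} {n : nat}.
Implicit Types (alpha beta : superform R n.+1) (x v : 'rV[R]_n.+1) (y :
  'rV[R]_n).

Local Notation U := (@halfspace R n).

(** Cartan's formula by hand: since delta alpha = 0, the contraction is the derivative of alpha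
    along x plus the number operator. Euler's identity gives -|I| for the first, the second gives
    |I|. *)
Lemma contract_x_extd alpha x : conic alpha -> U x ->
  differentiable_form alpha x -> ladder_sum false (pairv x 0) (extd alpha x) =
    0.
Proof.
move=> [ha ax _] Ux da; rewrite extdE linear_sum /=.
have term j : ladder_sum false (pairv x 0) (ladder true (inl j) (partialv 'e_j
  alpha x))
  = x 0 j *: partialv 'e_j alpha x + ladder true (inl j) (ladder false (inl j)
    (alpha x)).
  rewrite ladder_sum_ladder mul1r /= (contract_partial (@open_halfspace R n) Ux
    ax
    (is_derive_pair_x x 'e_j) da).
  by rewrite ladder_sum_unit_x linearN opprK.
rewrite (eq_bigr _ (fun j _ => term j)) big_split; apply/ffunP=> A.
rewrite ffunE number_op sum_ffunE [RHS]ffunE.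
have -> : \sum_j (x 0 j *: partialv 'e_j alpha x) A = partialv x alpha x A.
  rewrite [RHS]ffunE derive_sum_partials; last exact: da.
  by apply: eq_bigr => j _; rewrite !ffunE.
by rewrite euler // addNr.
Qed.

Lemma contract_xi_extd alpha x : conic alpha -> U x ->
  differentiable_form alpha x ->
  ladder_sum false (pairv 0 x) (extd alpha x) = superT alpha x.
Proof.
move=> [ha _ axi] Ux da; rewrite extdE linear_sum superTE;
  apply: eq_bigr => j _ /=.
rewrite ladder_sum_ladder /= mxE mulr0 scale0r sub0r.
rewrite (contract_partial (@open_halfspace R n) Ux axi (is_derive_pair_xi x
  'e_j) da).
by rewrite ladder_sum_unit_xi linearN opprK.
Qed.

(** The factor l contributed by dx_j is absorbed by the chain rule for the partial derivative. *)
Lemma homogeneous_extd alpha : homogeneous alpha ->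
  (forall x, U x -> differentiable_form alpha x) -> homogeneous (extd alpha).
Proof.
move=> ha da x l Ux l0; rewrite !extdE linear_sum; apply: eq_bigr => j _ /=.
rewrite dilate_creation_x -(partial_homogeneous _ ha Ux l0) ?linearZ //.
exact/da/halfspaceZ.
Qed.

Lemma slice_superT alpha y :
  slice (superT alpha (inclH0 y)) = superT (fun y =>
    slice (alpha (inclH0 y))) y.
Proof.
rewrite !superTE big_ord_recl linearD linear_sum /= slice_ladder0 ?eqxx //
  add0r.
apply: eq_bigr => j _.
by rewrite (slice_ladder true (inl j)) (slice_ladder false (inr j)).
Qed.

Lemma slice_extd alpha y :
  slice (extd alpha (inclH0 y)) = extd (fun y => slice (alpha (inclH0 y))) y.
Proof.
rewrite !extdE big_ord_recl linearD linear_sum /= slice_ladder0 ?eqxx // add0r.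
apply: eq_bigr => j _; rewrite (slice_ladder true (inl j)); congr ladder.
apply/ffunP=> A; rewrite !ffunE /derive.
set g1 := fun h => h^-1 *: _; set g2 := fun h => h^-1 *: _.
suff -> : g1 = g2 by [].
(* The difference quotients agree because a shift of y by h e_j shifts [inclH0 y] by h times the
   lifted basis vector. *)
apply/funext=> h; rewrite /g1 /g2 /= !ffunE; congr (_ *: (alpha _ _ - _)).
apply/rowP=> i; rewrite !mxE; case: unliftP => [k|] -> /=.
  by rewrite !mxE (inj_eq lift_inj).
by rewrite ?andbF mulr0 add0r.
Qed.

(** Each summand contributes x_j times the contraction of alpha in the dxi_j direction, and these
    add up to delta^# alpha = 0. *)
Lemma contract_x_superT alpha x : conic alpha -> U x ->
  ladder_sum false (pairv x 0) (superT alpha x) = 0.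
Proof.
move=> [_ ax axi] Ux; rewrite superTE linear_sum /=.
have term j : ladder_sum false (pairv x 0) (ladder true (inl j) (ladder false
  (inr j) (alpha x)))
   = x 0 j *: ladder false (inr j) (alpha x).
  rewrite !ladder_sum_ladder ax // eqxx mul0r scale0r sub0r mul1r linear0 oppr0.
  by rewrite linear0 subr0.
rewrite (eq_bigr _ (fun j _ => term j)); have := axi x Ux.
rewrite /ladder_sum big_sumType /= [X in X + _]big1 ?add0r // => i _.
by rewrite mxE scale0r.
Qed.

Lemma contract_xi_superT alpha x : conic alpha -> U x ->
  ladder_sum false (pairv 0 x) (superT alpha x) = 0.
Proof.
move=> [_ ax axi] Ux; rewrite superTE linear_sum big1 // => j _ /=.
rewrite !ladder_sum_ladder /= mxE mulr0 scale0r sub0r axi // mul0r scale0r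
  sub0r.
by rewrite !linear0.
Qed.

Lemma dilate_superT alpha x l : homogeneous alpha -> U x -> 0 < l ->
  dilate l (superT alpha (l *: x)) = l *: superT alpha x.
Proof.
move=> ha Ux l0; rewrite !superTE linear_sum scaler_sumr;
  apply: eq_bigr => j _ /=.
by rewrite dilate_creation_x dilate_ladder_xi ha.
Qed.

Lemma superT_eq0 alpha : conic alpha ->
  (forall y, superT (fun y => slice (alpha (inclH0 y))) y = 0) ->
  forall x, U x -> superT alpha x = 0.
Proof.
(* T replaces a dxi by a dx, which spoils homogeneity by one factor l; division by x_0 restores
   it. *)
move=> ca T0 x Ux; pose beta : superform R n.+1 := fun z =>
  (z 0 ord0)^-1 *: superT alpha z.
have cb : conic beta.
  split=> [z l Uz l0|z Uz|z Uz]; rewrite /beta linearZ /=.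
  - have [ha _ _] := ca; rewrite dilate_superT // scalerA mxE; congr (_ *: _).
    by rewrite invfM mulrAC mulVf ?mul1r // gt_eqF.
  - by rewrite contract_x_superT // scaler0.
  - by rewrite contract_xi_superT // scaler0.
have : beta x = 0.
  apply: (conic_ext cb (@conic0 R n)) => // y.
  by rewrite linearZ /= slice_superT T0 scaler0 linear0.
move=> /eqP; rewrite scaler_eq0 invr_eq0 => /orP[|/eqP //].
by rewrite gt_eqF.
Qed.

Lemma bidegree_extd N p q (V : set 'rV[R]_N) (alpha : superform R N) :
  open V -> has_bidegree p q V alpha -> has_bidegree p.+1 q V (extd alpha).
Proof.
move=> oV pq x Vx; rewrite extdE; apply: bidegree_sum => j.
apply: (@bidegree_creation _ _ _ _ (inl j)) => I K; rewrite /coef ffunE => D0.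
have [/andP[/eqP-> /eqP->] //|IK] := boolP ((#|I| == p) && (#|K| == q)).
case/eqP: D0; rewrite -(derive_cst (0 : R) x 'e_j); apply: near_eq_derive.
have := near_open oV Vx; apply: filterS => z Vz /=; apply/eqP.
by apply: contraNT IK => /(pq z Vz)[-> ->]; rewrite !eqxx.
Qed.

Lemma extd_ext alpha beta : (forall x, U x -> alpha x = beta x) ->
  forall x, U x -> extd alpha x = extd beta x.
Proof.
move=> ab x Ux; rewrite !extdE; apply: eq_bigr => j _; congr ladder.
apply/ffunP=> A; rewrite !ffunE; apply: near_eq_derive.
have := near_open (@open_halfspace R n) Ux; apply: filterS => z Uz.
by rewrite ab.
Qed.

Lemma smooth_differentiable alpha x :
  smooth_superform U alpha -> U x -> differentiable_form alpha x.
Proof.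
move=> sa Ux [I K].
exact: (@is_C1_differentiable _ _ _ (@open_halfspace R n) _ _ _ (sa I K 1%N)
  Ux).
Qed.

Lemma weakly_positiveZ N p k (a : extalg R N) :
  0 <= k -> weakly_positive p a -> weakly_positive p (k *: a).
Proof.
move=> k0 [pa sa wa]; split; first exact: bidegreeZ.
  by move=> I K; have := sa I K; rewrite /coef !ffunE => ->.
move=> m F pm /(wa m F pm)[f fE f0]; exists (k * f); last exact: mulr_ge0.
by rewrite wedgeZl fE scalerA.
Qed.

End ConicDerivative.

(** * Existence, uniqueness, exterior derivative and positivity of the extension *)

Theorem theorem9p1 (R : realType) (n p q : nat) (Omega' : superform R n)
    (smooth_Omega' : smooth_superform setT Omega')
    (bideg_Omega' : has_bidegree p q setT Omega') :
  (exists Omega : superform R n.+1,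
     [/\ is_extension p q Omega' Omega,
         smooth_superform (@halfspace R n) Omega &
         forall Omega2 : superform R n.+1, is_extension p q Omega' Omega2 ->
           forall x, halfspace x -> Omega2 x = Omega x]) /\
  [/\ (forall x, halfspace x -> extd (extension p q Omega') x = 0) <->
        (forall x, extd Omega' x = 0) /\ (forall x, superT Omega' x = 0),
      (forall x, superT Omega' x = 0) ->
        forall x, halfspace x ->
          extd (extension p q Omega') x = extension p.+1 q (extd Omega') x,
      p = q -> (forall x, weakly_positive p (Omega' x)) ->
        forall x, halfspace x -> weakly_positive p (extension p q Omega' x) &
      p = q -> (forall x, strongly_positive p (Omega' x)) ->
        forall x, halfspace x -> strongly_positive p (extension p q Omega' x)].
Proof.
have F_ext := form_extensionP bideg_Omega'.
set F := form_extension p Omega' in F_ext.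
have F_smooth : smooth_superform (@halfspace R n) F by exact:
  smooth_form_extension.
have unique a r s (O1 O2 : superform R n.+1) : is_extension r s a O1 ->
    is_extension r s a O2 -> forall x, halfspace x -> O1 x = O2 x.
  move=> /is_extensionE[_ c1 s1] /is_extensionE[_ c2 s2];
    apply: conic_ext => // y.
  by rewrite s1 s2.
(* [extension] is an unspecified choice among the extensions; by uniqueness it agrees on x_0 > 0
   with any explicit one. *)
have extensionE (a : superform R n) r s O : is_extension r s a O ->
    forall x, halfspace x -> extension r s a x = O x.
  move=> HO; apply: (unique _ _ _ _ _ _ HO).
  exact: (xgetPex _ (ex_intro _ O HO)).
split; first by exists F; split=> // O2 HO2;
  exact: (unique _ _ _ _ _ HO2 F_ext).
have /is_extensionE[pqF cF sF] := F_ext.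
have dF x : halfspace x -> differentiable_form F x by exact:
  smooth_differentiable.
have EF := extensionE _ _ _ _ F_ext.
have dEF : forall x, halfspace x -> extd (extension p q Omega') x = extd F x.
  exact: extd_ext.
have sFE : (fun y => slice (F (inclH0 y))) = Omega' by apply/funext.
have TF : (forall y, superT Omega' y
  = 0) -> forall x, halfspace x -> superT F x = 0.
  by move=> T0; apply: superT_eq0 => // y; rewrite sFE.
have c_dF : (forall y, superT Omega' y = 0) -> conic (extd F).
  move=> T0; split; first by apply: homogeneous_extd => //; case: cF.
    by move=> x Ux; rewrite contract_x_extd //; exact: dF.
  by move=> x Ux; rewrite contract_xi_extd ?TF //; exact: dF.
have s_dF y : slice (extd F (inclH0 y))
  = extd Omega' y by rewrite slice_extd sFE.
split.
- split=> [dE0|[dO0 T0] x Ux].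
    have dF0 x : halfspace x -> extd F x = 0 by move=> Ux; rewrite -dEF ?dE0.
    split=> y; first by rewrite -s_dF dF0 ?linear0 //; exact: halfspace_inclH0.
    have U1 := halfspace_inclH0 y.
    (* The contraction of dF = 0 with E^# gives T F = 0, which is then restricted to H_0. *)
    have := contract_xi_extd cF U1 (dF _ U1);
      rewrite dF0 // linear0 => /esym T0.
    by rewrite -sFE -slice_superT T0 linear0.
  rewrite dEF //; apply: (conic_ext (c_dF T0) (@conic0 R n)) => // y.
  by rewrite s_dF dO0 linear0.
- move=> T0 x Ux; rewrite dEF //; apply/esym/extensionE => //.
  apply/is_extensionE; split=> //; last exact: c_dF.
  exact: bidegree_extd (@open_halfspace R n) pqF.
- move=> pq wO x Ux; rewrite EF //; have [_ ax axi] := cF.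
  have x0 : x 0 ord0 != 0 by rewrite gt_eqF.
  apply: (weakly_positive_slice x0) => //; [by rewrite {2}pq;
    exact: pqF|exact: ax|exact: axi|].
  (* At any x of the half-space, dropping the dx_0 and dxi_0 terms leaves x_0^(-p) times [Omega'] at
     [proj x], a nonnegative multiple of a positive form. *)
  rewrite slice_form_extension //; apply: weakly_positiveZ => //.
  by rewrite exprn_ge0 // invr_ge0 ltW.
- move=> pq sO x Ux; rewrite EF //; have [_ ax axi] := cF.
  have x0 : x 0 ord0 != 0 by rewrite gt_eqF.
  apply: (strongly_positive_slice x0); [exact: ax|exact: axi|].
  rewrite slice_form_extension //; apply: strongly_positiveZ => //.
  by rewrite exprn_ge0 // invr_ge0 ltW.
Qed.
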